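(* Let $J \subset \mathbb{R}$ be an interval, let $\mathfrak{m}^0, \mathfrak{m}^1, \mathfrak{m}^2, \dots$ be speed measures on $J$, and for each $n \in \mathbb{Z}_+ = \{0,1,2,\dots\}$ let $(x \mapsto P^n_x)$ be the regular diffusion on natural scale with state space $J$ and speed measure $\mathfrak{m}^n$. If $P^n_x \to P^0_x$ weakly as $n \to \infty$ for every $x \in J$, then $\mathfrak{m}^n \Rightarrow \mathfrak{m}^0$, i.e. $(\mathfrak{m}^n)_{n \geq 1}$ converges to $\mathfrak{m}^0$ in the speed measure sense.
   Context: Setting. $J \subset \mathbb{R}$ is a (non-degenerate) finite or infinite, closed, open or half-open interval with left boundary point $l$, right boundary point $r$ and interior $J^\circ = (l,r)$. $\Omega$ is the space of continuous functions $\mathbb{R}_+ \to J$ with the local uniform topology, $\mathsf{X}_t(\omega) = \omega(t)$ is the coordinate process, $\mathcal{F} = \sigma(\mathsf{X}_s, s \geq 0)$ is the Borel $\sigma$-field, $\mathcal{F}_t = \sigma(\mathsf{X}_s, s \leq t)$, and $(\theta_t \omega)(s) = \omega(t+s)$. $\mathcal{M}_1$ is the set of probability measures on $(\Omega, \mathcal{F})$ with the weak topology. Diffusions. A map $J \ni x \mapsto P_x \in \mathcal{M}_1$ is a (canonical) diffusion if $x \mapsto P_x(A)$ is measurable for all $A \in \mathcal{F}$, $P_x(\mathsf{X}_0 = x) = 1$ for all $x \in J$, and (strong Markov property) for every $(\mathcal{F}_{t+})_{t \geq 0}$-stopping time $\tau$ and every $x \in J$, $P_{\mathsf{X}_\tau}$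 is the regular conditional $P_x$-distribution of $\theta_\tau \mathsf{X}$ given $\mathcal{F}_{\tau+}$ on $\{\tau < \infty\}$. Let $\gamma_y = \inf(s \geq 0 : \mathsf{X}_s = y)$. The diffusion is regular if $P_x(\gamma_y < \infty) > 0$ for all $x \in J^\circ$, $y \in J$. A regular diffusion is on natural scale if $P_x(\gamma_b < \gamma_a) = \frac{x-a}{b-a}$ for all $a < x < b$ in $J$. Speed measures. For a regular diffusion $(x\mapsto P_x)$ on natural scale there is a unique locally finite measure $\mathfrak{m}$ on $J^\circ$ with $E_x[\gamma_a \wedge \gamma_b] = \int G_{(a,b)}(x,y)\, \mathfrak{m}(dy)$ for all $[a,b] \subset J^\circ$, $a<b$, and $x \in [a,b]$, where $G_{(a,b)}(x,y) = \frac{2 (x\wedge y - a)(b - x \vee y)}{b-a}$ for $x,y \in [a,b]$ and $G_{(a,b)}(x,y)=0$ otherwise. If $l \in J$, then $\mathfrak{m}(\{l\}) \in [0,\infty]$ is defined such that $E_x[\gamma_b] = \int G_{[l,b)}(x,y)\, \mathfrak{m}(dy)$ for all $b \in J^\circ$, $x \in [l,b]$, where $G_{[l,b)}(x,y) = 2(b - x\vee y)$ for $x,y \in [l,b]$ and $0$ otherwise; if $l$ is absorbing (i.e. $P_l(\gamma_y<\infty)=0$ for $y \in J^\circ$), $\mathfrak{m}(\{l\}) = \infty$. Analogously for $r$ if $r \in J$. The resulting measure $\mathfrak{m}$ on $(J, \mathcal{B}(J))$ is the speed measure of the diffusion; it determines the regular diffusion on natural scale uniquely. A speed measure on $J$ is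 a measure arising in this way. Convergence in the speed measure sense. $\mathfrak{m}^n \Rightarrow \mathfrak{m}^0$ means: (a) $\int_{J^\circ} f\, d\mathfrak{m}^n \to \int_{J^\circ} f\, d\mathfrak{m}^0$ for all $f \in C_c(J^\circ)$; (b) if $l \in J$, then $\int f\, d\mathfrak{m}^n \to \int f\, d\mathfrak{m}^0$ (in $[0,\infty]$) for all $0 \leq f \in C(J)$ such that $f(l) > 0$ and $f = 0$ off $[l,y)$ for some $y \in J^\circ$; (c) if $r \in J$, then $\int f\, d\mathfrak{m}^n \to \int f\, d\mathfrak{m}^0$ (in $[0,\infty]$) for all $0 \leq f \in C(J)$ such that $f(r) > 0$ and $f = 0$ off $(y,r]$ for some $y \in J^\circ$. *)

(* Defs.v *)
From HB Require Import structures.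
From mathcomp Require Import all_boot all_order all_algebra.
From mathcomp Require Import all_classical all_reals all_analysis.
From mathcomp Require Import measurable_realfun.
Import Order.TTheory GRing.Theory Num.Theory.
Import numFieldNormedType.Exports.

Set Implicit Arguments.
Unset Strict Implicit.
Unset Printing Implicit Defensive.

Local Open Scope classical_set_scope.
Local Open Scope ring_scope.

(* The library's measurable types are pointed; bundling the non-degeneracy of
   the interval with it makes the state and path spaces below inhabited. *)
Record nd_interval (R : realType) := NdInterval {
  nd_set :> set R ;
  nd_is_interval : is_interval nd_set ;
  nd_nondegenerate : exists x y, [/\ nd_set x, nd_set y & x < y] }.

Section time.
Variable R : realType.

Definition time : Type := set_type [set t : R | 0 <= t].
HB.instance Definition _ := SubType.on time.
HB.instance Definition _ := PseudoMetric.on time.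

Lemma to_time_subproof (t : R) : Num.max 0 t \in [set t : R | 0 <= t].
Proof. by rewrite mem_set//= le_max lexx. Qed.

(* Truncates at 0; only used for 0 <= t. *)
Definition to_time (t : R) : time := exist _ (Num.max 0 t) (to_time_subproof t).

Lemma continuous_to_time : continuous to_time.
Proof.
apply/continuous_comp_initial => t.
by apply: continuous_max; [exact: cst_continuous|exact: cvg_id].
Qed.

Lemma continuous_time_val : continuous (val : time -> R).
Proof. exact: (@initial_continuous _ _ (set_val : time -> R)). Qed.

Definition time_add (t s : time) : time := to_time (val t + val s).

Lemma val_time_add (t s : time) : val (time_add t s) = val t + val s.
Proof.
have t0 := set_valP t; have s0 := set_valP s.
by apply/max_idPr; apply: addr_ge0.
Qed.

Lemma continuous_time_add (t : time) : continuous (time_add t).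
Proof.
move=> s; apply: (@continuous_comp _ _ _ (fun s : time => val t + val s)).
  have vs : val x @[x --> s] --> (val s : R^o) := @continuous_time_val s.
  exact: cvgD (cvg_cst (val t : R^o)) vs.
exact: continuous_to_time.
Qed.

End time.

Section spaces.
Variables (R : realType) (J : nd_interval R).

Definition state : Type := set_type (nd_set J).
HB.instance Definition _ := SubType.on state.
HB.instance Definition _ := PseudoMetric.on state.

Lemma state_inhabited : exists x : state, True.
Proof.
have [x [_ [Jx _ _]]] := nd_nondegenerate J.
by exists (exist _ x (mem_set Jx)).
Qed.
HB.instance Definition _ :=
  isPointed.Build state (projT1 (cid state_inhabited)).
HB.instance Definition _ :=
  Measurable.copy state (g_sigma_algebraType (@open state)).

(* The interior of J in R, not its (full) interior as a subspace. *)
Definition inner : set state := [set x | (nd_set J)° (val x)].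

Definition is_left_end (l : state) := forall x : state, val l <= val x.
Definition is_right_end (r : state) := forall x : state, val x <= val r.

(* Uniform convergence on compact sets of times. *)
Definition path_space : Type := continuousType (time R) state.
HB.instance Definition _ := Choice.on path_space.
HB.instance Definition _ := Uniform.copy path_space
  (initial_topology
     (fun w : path_space => (w : {family compact, time R -> state}))).

Definition coordinate (t : time R) (w : path_space) : state := w t.

HB.instance Definition _ :=
  isPointed.Build path_space (mkcts (@cst_continuous (time R) state point)).
HB.instance Definition _ := Measurable.copy path_space
  (g_sigma_algebraType
     (\bigcup_(t in [set: time R])
        preimage_set_system setT (coordinate t) measurable)).

Definition path_shift (t : time R) (w : path_space) : path_space :=
  mkcts (fun s => continuous_comp
    (@continuous_time_add R t s) (@cts_fun _ _ w (time_add t s))).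

Lemma path_shiftE t w s :
  coordinate s (path_shift t w) = coordinate (time_add t s) w.
Proof. by []. Qed.

End spaces.

Section diffusions.
Variables (R : realType) (J : nd_interval R).
Local Notation state := (state J).
Local Notation Omega := (path_space J).
Local Notation Jo := (@inner R J).

Definition hit (y : R) (w : Omega) : \bar R :=
  ereal_inf [set (val t)%:E | t in [set t : time R | val (coordinate t w) = y]].

Definition Ft (t : R) : set (set Omega) :=
  <<s \bigcup_(s in [set s : time R | val s <= t])
        preimage_set_system setT (@coordinate R J s) measurable >>.

Definition Ft_plus (t : R) : set (set Omega) :=
  [set A | forall s, t < s -> Ft s A].

(* Stopping times of the filtration (Ft_plus t)_(t >= 0). *)
Definition stopping_time (tau : Omega -> \bar R) :=
  (forall w, 0 <= tau w)%E /\
  (forall t, 0 <= t -> Ft_plus t [set w | tau w <= t%:E]%E).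

Definition Ftau_plus (tau : Omega -> \bar R) : set (set Omega) :=
  [set A | measurable A /\
    forall t, 0 <= t -> Ft_plus t (A `&` [set w | tau w <= t%:E]%E)].

(* The next two are only used on {tau < +oo}. *)
Definition stopped (tau : Omega -> \bar R) (w : Omega) : state :=
  coordinate (to_time (fine (tau w))) w.

Definition path_shift_at (tau : Omega -> \bar R) (w : Omega) : Omega :=
  path_shift (to_time (fine (tau w))) w.

Implicit Types P : state -> probability Omega R.

(* w |-> P (stopped tau w) is the regular conditional distribution under P x of
   path_shift_at tau given Ftau_plus tau on {tau < +oo}: for each event A, it is
   measurable with respect to Ftau_plus tau on {tau < +oo}, and it has the right
   integral over each event of Ftau_plus tau contained in {tau < +oo}. *)
Definition strong_Markov P := forall (tau : Omega -> \bar R),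
  stopping_time tau -> forall (x : state) (A : set Omega), measurable A ->
  (forall B : set (\bar R), measurable B -> Ftau_plus tau
     ([set w | tau w < +oo]%E `&` [set w | B (P (stopped tau w) A)])) /\
  (forall C, Ftau_plus tau C ->
     P x (C `&` [set w | tau w < +oo]%E `&` path_shift_at tau @^-1` A) =
     \int[P x]_(w in C `&` [set w | tau w < +oo]%E) P (stopped tau w) A)%E.

Definition diffusion P :=
  [/\ forall A, measurable A -> measurable_fun setT (fun x => P x A),
      forall x, P x [set w | coordinate (to_time 0) w = x] = 1%E
    & strong_Markov P].

Definition regular_diffusion P := forall x y : state, Jo x ->
  (0 < P x [set w | hit (val y) w < +oo])%E.

Definition natural_scale P := forall a x b : state,
  val a < val x -> val x < val b ->
  P x [set w | hit (val b) w < hit (val a) w]%E =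
  ((val x - val a) / (val b - val a))%:E.

Definition green (a b x y : R) : R :=
  if (a <= x <= b) && (a <= y <= b)
  then 2 * (Num.min x y - a) * (b - Num.max x y) / (b - a) else 0.

Definition green_left (l b x y : R) : R :=
  if (l <= x <= b) && (l <= y <= b) then 2 * (b - Num.max x y) else 0.

Definition green_right (a r x y : R) : R :=
  if (a <= x <= r) && (a <= y <= r) then 2 * (Num.min x y - a) else 0.

Definition absorbing P (z : state) := forall y : state, Jo y ->
  P z [set w | hit (val y) w < +oo]%E = 0%E.

Implicit Types m : {measure set state -> \bar R}.

Definition locally_finite_inner m := forall x : state, Jo x ->
  exists U : set state, [/\ open U, U x & m U < +oo]%E.

Definition speed_measure_of P m :=
  [/\ locally_finite_inner m,
      forall a b x : state, Jo a -> Jo b -> val a < val b ->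
        val a <= val x <= val b ->
        (\int[P x]_w mine (hit (val a) w) (hit (val b) w) =
         \int[m]_(y in Jo)
           (green (val a) (val b) (val x) (val y))%:E)%E,
      forall l : state, is_left_end l ->
        (forall b x : state, Jo b -> val l <= val x <= val b ->
          (\int[P x]_w hit (val b) w =
           \int[m]_y (green_left (val l) (val b) (val x) (val y))%:E)%E) /\
        (absorbing P l -> m [set l] = +oo%E)
    & forall r : state, is_right_end r ->
        (forall a x : state, Jo a -> val a <= val x <= val r ->
          (\int[P x]_w hit (val a) w =
           \int[m]_y (green_right (val a) (val r) (val x) (val y))%:E)%E) /\
        (absorbing P r -> m [set r] = +oo%E)].

Definition weak_cvg (mu_ : nat -> probability Omega R)
    (mu : probability Omega R) :=
  forall f : Omega -> R, continuous f -> bounded_fun (f : Omega -> R^o) ->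
  (\int[mu_ n]_w (f w)%:E)%E @[n --> \oo] --> (\int[mu]_w (f w)%:E)%E.

Definition speed_cvg (m_ : nat -> {measure set state -> \bar R}) m :=
  [/\ forall f : state -> R, continuous f ->
        (exists K, [/\ compact K, K `<=` Jo
                    & forall x, ~ K x -> f x = 0]) ->
        (\int[m_ n]_(x in Jo) (f x)%:E)%E @[n --> \oo] -->
        (\int[m]_(x in Jo) (f x)%:E)%E,
      forall l : state, is_left_end l ->
        forall f : state -> R, continuous f ->
        (forall x, 0 <= f x) -> 0 < f l ->
        (exists2 y : state, Jo y &
           forall x : state, val y <= val x -> f x = 0) ->
        (\int[m_ n]_x (f x)%:E)%E @[n --> \oo] --> (\int[m]_x (f x)%:E)%E
    & forall r : state, is_right_end r ->
        forall f : state -> R, continuous f ->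
        (forall x, 0 <= f x) -> 0 < f r ->
        (exists2 y : state, Jo y &
           forall x : state, val x <= val y -> f x = 0) ->
        (\int[m_ n]_x (f x)%:E)%E @[n --> \oo] --> (\int[m]_x (f x)%:E)%E].

End diffusions.

(* Main.v *)
(* The exit time of the open ball of radius [d] around [x] has expectation
   [c * int (d - |y - x|)^+ m(dy)], with [c = 1] if the ball stays in the interior
   and [c = 2] if [x] is an endpoint of [J].  Hence everything reduces to the
   convergence of these expectations: the tents span a class of functions dense
   enough for the convergence in the speed measure sense.

   The functional [inf_s min(t, s + (t/e) * (d - |w s - x|)^+)] is continuous on
   path space and lies between the exit times of the balls of radius [d - e] and
   [d], both truncated at [t].  Weak convergence therefore compares the truncated
   expected exit times up to a change of radius, and the limiting expectation
   depends continuously on the radius by the tent formula.  Uniform integrability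
   follows from the Markov property at time [t] together with the bound
   [E_y exit <= 2 * E_x exit], which is an inequality between Green kernels.  At an
   endpoint one first needs finiteness of the expectation for large [n]: a path
   from [x] has to pass through every [y] of the ball before leaving it, so by the
   strong Markov property the exit time has uniformly geometric tails. *)

Require Import Defs.
From HB Require Import structures.
From mathcomp Require Import all_boot all_order all_algebra.
From mathcomp Require Import all_classical all_reals all_analysis.
From mathcomp Require Import measurable_realfun ring lra.
Import Order.TTheory GRing.Theory Num.Theory.
Import numFieldNormedType.Exports.

Set Implicit Arguments.
Unset Strict Implicit.
Unset Printing Implicit Defensive.

Local Open Scope classical_set_scope.
Local Open Scope ring_scope.

(** * Hitting times of continuous paths *)

(** The exit time itself is not continuous on path space: a path may touch the boundary of a ball
    without crossing it, and nearby paths then leave much later. The two one-sided bounds for the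
    expectations are not symmetric. Truncation only lowers an expectation, so the lower bound holds
    even for an infinite limit. The upper bound comes from E exit <= E min(exit, t) + 2 * E exit *
    P(exit > t), whose last term can be absorbed on the left only once E exit is known to be finite.
    In the interior, local finiteness of the speed measure provides this; at an endpoint the mass
    may be infinite, even for some n when the limit is finite. The same obstacle shapes the passage
    from tents to a test function f at an endpoint z. If the tents at z have infinite integral, so
    has f, because f is positive at z. Otherwise, subtracting the multiple of a tent with value f z
    at z leaves a function vanishing at z, which is approximated by functions with compact support
    in the interior. *)

Section paths.
Variables (R : realType) (J : nd_interval R).
Local Notation state := (state J).
Local Notation Omega := (path_space J).
Implicit Types (g : state -> R) (w : Omega).

Lemma time_ge0 (t : time R) : 0 <= val t.
Proof. exact: set_valP t. Qed.

Lemma val_to_time (t : R) : 0 <= t -> val (to_time t) = t.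
Proof. by move=> t0; apply/max_idPr. Qed.

Lemma to_timeK (t : time R) : to_time (val t) = t.
Proof. by apply/val_inj/val_to_time/time_ge0. Qed.

Lemma continuous_path_fun g w : continuous g ->
  continuous (fun t : R => g (w (to_time t))).
Proof.
move=> cg t.
apply: (@continuous_comp _ _ _ (fun t => w (to_time t)) g); last exact: cg.
apply: (@continuous_comp _ _ _ (@to_time R) w); first exact: continuous_to_time.
exact: cts_fun.
Qed.

Lemma continuous_normB g (c : R) : continuous g -> continuous (fun x => `|g x - c|).
Proof.
move=> cg x; apply: (@continuous_comp _ _ _ g (fun u : R => `|u - c|)).
  exact: cg.
apply: (@cvg_norm _ R^o).
by apply: (@cvgB _ R^o); [exact: cvg_id|exact: cvg_cst].
Qed.

(** [hit y] is the case [g = val]. Taking for [g] the distance from a point turns the exit time of a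
    ball into the hitting time of a level, so one measurability argument serves for all radii. *)
Definition hitg g (c : R) w : \bar R :=
  ereal_inf [set (val t)%:E | t in [set t : time R | g (w t) = c]].

Lemma hitg_lb g c w t : g (w t) = c -> (hitg g c w <= (val t)%:E)%E.
Proof. by move=> gt; apply: ereal_inf_lbound; exists t. Qed.

Lemma hitg_ge0 g c w : (0 <= hitg g c w)%E.
Proof.
by apply: le_ereal_inf_tmp => _ [t _ <-]; rewrite lee_fin time_ge0.
Qed.

(** The infimum is attained. If the minimum of |g(w) - c| over [0, t] were positive, continuity
    would keep the distance positive up to some [t + e], and the hitting time would exceed [t]. *)
Lemma hitg_leP g c w (t : R) : continuous g ->
  (hitg g c w <= t%:E)%E <-> exists2 s : time R, val s <= t & g (w s) = c.
Proof.
move=> cg; split=> [ht|[s st gs]]; last first.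
  by rewrite (le_trans (hitg_lb gs))// lee_fin.
have [t0|t0] := ltP t 0.
  by have := le_trans (hitg_ge0 g c w) ht; rewrite lee_fin leNgt t0.
pose f (u : R) : R := `|g (w (to_time u)) - c|.
have cf : continuous f := @continuous_path_fun _ w (continuous_normB cg).
have t1 : 0 <= t + 1 by rewrite addr_ge0.
have [u] := EVT_min t0 (continuous_subspaceT cf).
rewrite in_itv/= => /andP[u0 ut] fmin.
exists (to_time u); first by rewrite val_to_time.
apply/eqP; rewrite -subr_eq0 -normr_eq0 -/(f u); apply: contraT => fu0.
have {fu0} fu0 : 0 < f u by rewrite lt_neqAle eq_sym fu0 /f normr_ge0.
have : \forall v \near t, 0 < f v.
  have cft : f v @[v --> t] --> f t by exact: cf.
  by apply: (cvgr_gt _ cft); rewrite (lt_le_trans fu0)// fmin// in_itv/= t0 lexx.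
move=> /nbhs_ballP[e /= e0 He].
suff : (t%:E < hitg g c w)%E by rewrite ltNge ht.
apply: (@lt_le_trans _ _ (t + e)%:E); first by rewrite lte_fin ltrDl.
apply: le_ereal_inf_tmp => _ [s /= gs <-]; rewrite lee_fin leNgt; apply/negP => ste.
have fs : f (val s) = 0 by rewrite /f to_timeK gs subrr normr0.
have [st|ts] := leP (val s) t.
  have /fmin : val s \in `[0, t] by rewrite in_itv/= time_ge0 st.
  by rewrite fs leNgt fu0.
suff : 0 < f (val s) by rewrite fs ltxx.
apply: He.
by rewrite /ball/= ltr0_norm ?subr_lt0// opprB ltrBlDl.
Qed.

(** The cap keeps all sampled times in [0, t], so that countable operations over them stay in
    [Ft t]. *)
Definition rat_time (t : R) (q : rat) : time R := to_time (Num.min t (ratr q)).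

Lemma val_rat_time t q : 0 <= t -> val (rat_time t q) <= t.
Proof.
by move=> t0; rewrite /= ge_max t0 ge_min lexx.
Qed.

Lemma rat_time_dense (f : R -> R) (t r : R) (s : time R) :
  continuous f -> val s <= t -> f (val s) < r ->
  exists q, f (val (rat_time t q)) < r.
Proof.
move=> cf st fs.
(* Clamping to [0, t] lets a rational on either side of [s] serve, also when [s] is 0 or [t]. *)
pose h (u : R) := Num.max 0 (Num.min t u).
have ch : continuous h.
  move=> u; apply: continuous_max; first exact: cst_continuous.
  by apply: continuous_min; [exact: cst_continuous|exact: cvg_id].
have hs : h (val s) = val s.
  by rewrite /h (min_idPr st); apply/max_idPr/time_ge0.
have cfh : f (h v) @[v --> val s] --> f (h (val s)).
  exact: (@continuous_comp _ _ _ h f _ (ch _) (cf _)).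
have : \forall v \near val s, f (h v) < r.
  by apply: (cvgr_lt _ cfh); rewrite hs.
move=> /nbhs_ballP[e /= e0 He].
have [q] : exists q, ratr q \in `]val s - e, val s + e[.
  by apply: rat_in_itvoo; lra.
rewrite in_itv/= => /andP[q1 q2]; exists q.
apply: He; rewrite /ball/= ltr_distlC; apply/andP; split; lra.
Qed.

Lemma inf_path_lt_measurable g (t r : R) : continuous g -> 0 <= t ->
  Ft t [set w : Omega | exists2 s : time R, val s <= t & g (w s) < r].
Proof.
move=> cg t0.
have -> : [set w : Omega | exists2 s : time R, val s <= t & g (w s) < r] =
    \bigcup_q [set w : Omega | g (w (rat_time t q)) < r].
  apply/seteqP; split=> w /=.
    move=> [s st gs].
    have [||q] := @rat_time_dense (fun u => g (w (to_time u))) t r s _ st.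
    - exact: continuous_path_fun.
    - by rewrite to_timeK.
    by rewrite to_timeK => qr; exists q.
  by move=> [q _ qr]; exists (rat_time t q) => //; exact: val_rat_time.
apply: (@bigcupT_measurable_rat _ (g_sigma_algebraType
  (\bigcup_(s in [set s : time R | val s <= t])
        preimage_set_system setT (@coordinate R J s) measurable))) => q.
apply: sub_sigma_algebra; exists (rat_time t q); first exact: val_rat_time.
exists (g @^-1` `]-oo, r[); last first.
  by apply/seteqP; split=> w /=; rewrite in_itv/=; tauto.
by apply: sub_sigma_algebra; move/continuousP : cg; apply; exact: interval_open.
Qed.

Local Notation Ft_gen t := (\bigcup_(s in [set s : time R | val s <= t])
  preimage_set_system setT (@coordinate R J s) measurable).

Lemma Ft_setC (t : R) (A : set Omega) : Ft t A -> Ft t (~` A).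
Proof. exact: (@measurableC _ (g_sigma_algebraType (Ft_gen t))). Qed.

Lemma Ft_setI (t : R) (A B : set Omega) : Ft t A -> Ft t B -> Ft t (A `&` B).
Proof. exact: (@measurableI _ (g_sigma_algebraType (Ft_gen t))). Qed.

Lemma Ft_set0 (t : R) : Ft t (@set0 Omega).
Proof. exact: (@measurable0 _ (g_sigma_algebraType (Ft_gen t))). Qed.

Lemma Ft_mono (s t : R) (A : set Omega) : s <= t -> Ft s A -> Ft t A.
Proof.
move=> st; apply: sub_sigma_algebra2.
by move=> B [u us HB]; exists u => //=; exact: le_trans us st.
Qed.

Lemma Ft_measurable (t : R) (A : set Omega) : Ft t A -> measurable A.
Proof.
apply: sub_sigma_algebra2.
by move=> B [u _ HB]; exists u.
Qed.

Lemma open_measurable_state (U : set state) : open U -> measurable U.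
Proof. exact: sub_sigma_algebra. Qed.

Lemma closed_measurable_state (U : set state) : closed U -> measurable U.
Proof.
by move=> cU; rewrite -(setCK U); apply: measurableC; apply: open_measurable_state;
  exact: closed_openC.
Qed.

Lemma continuous_measurable_state g : continuous g -> measurable_fun setT g.
Proof.
move=> /continuousP cg; apply: (measurability _ (RGenOpens.measurableE R)).
move=> _ [_ [a [b ->] <-]]; rewrite setTI.
apply: open_measurable_state; apply: cg. exact: interval_open.
Qed.

Lemma Ft_coordinate (s : time R) (t : R) (B : set state) :
  val s <= t -> measurable B -> Ft t [set w : Omega | B (w s)].
Proof.
move=> st mB; apply: sub_sigma_algebra; exists s => //; exists B => //.
by rewrite setTI.
Qed.

(** By compactness of [0, t] the level is reached by time [t] exactly when it is approached within
    every 1/(k+1), and each such approach is an open condition that rational times detect. *)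
Lemma Ft_hitg g c (t : R) : continuous g ->
  Ft t [set w : Omega | (hitg g c w <= t%:E)%E].
Proof.
move=> cg; have [t0|t0] := ltP t 0.
  rewrite (_ : [set _ | _] = set0); first exact: Ft_set0.
  apply/seteqP; split=> // w /= /(le_trans (hitg_ge0 _ _ _)).
  by rewrite lee_fin leNgt t0.
have -> : [set w : Omega | (hitg g c w <= t%:E)%E] = \bigcap_(k : nat)
    [set w : Omega | exists2 s : time R, val s <= t & `|g (w s) - c| < k.+1%:R^-1].
  apply/seteqP; split=> w /=.
    move=> /hitg_leP[//|s st gs] k _; exists s => //.
    by rewrite gs subrr normr0 invr_gt0.
  move=> H; apply/hitg_leP => //.
  have cf : continuous (fun u : R => `|g (w (to_time u)) - c|) :=
    @continuous_path_fun _ w (continuous_normB cg).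
  have [u] := EVT_min t0 (continuous_subspaceT cf).
  rewrite in_itv/= => /andP[u0 ut] fmin.
  exists (to_time u); first by rewrite val_to_time.
  apply/eqP; rewrite -subr_eq0 -normr_eq0; apply: contraT => fu0.
  have {}fu0 : 0 < `|g (w (to_time u)) - c| by rewrite lt_neqAle eq_sym fu0 normr_ge0.
  have [k] := ltr_add_invr fu0; rewrite add0r => ku.
  have [s st gs] := H k I.
  have /fmin : val s \in `[0, t] by rewrite in_itv/= time_ge0 st.
  by rewrite to_timeK leNgt (lt_trans gs ku).
apply: (@bigcapT_measurable _ (g_sigma_algebraType (Ft_gen t))) => k.
exact: inf_path_lt_measurable (continuous_normB cg) t0.
Qed.

Lemma measurable_hitg g c : continuous g ->
  measurable_fun setT (hitg g c : Omega -> \bar R).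
Proof.
move=> cg; apply: (measurability _ (ErealGenOInfty.measurableE R)).
move=> _ [_ [r ->] <-]; rewrite setTI.
have -> : hitg g c @^-1` `]r%:E, +oo[ = ~` [set w | (hitg g c w <= r%:E)%E].
  by apply/seteqP; split=> w /=; rewrite in_itv/= andbT ltNge => /negP.
by apply: measurableC; apply: Ft_measurable; exact: Ft_hitg.
Qed.

Lemma stopping_time_hitg g c : continuous g -> stopping_time (@hitg g c).
Proof.
move=> cg; split=> [w|t t0 s ts]; first exact: hitg_ge0.
by apply: (@Ft_mono t); [exact: ltW|exact: Ft_hitg].
Qed.

End paths.

(** * Exit times of balls and their continuous surrogate *)

Section exit.
Variables (R : realType) (J : nd_interval R).
Local Notation state := (state J).
Local Notation Omega := (path_space J).
Implicit Types (w : Omega) (z d K t : R).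

Lemma continuous_state_val : continuous (val : state -> R).
Proof. exact: (@initial_continuous _ _ (set_val : state -> R)). Qed.

Definition dist_from z (x : state) : R := `|val x - z|.

Lemma continuous_dist_from z : continuous (dist_from z).
Proof. exact: continuous_normB continuous_state_val. Qed.

Definition exit z d w : \bar R := hitg (dist_from z) d w.

Definition soft_cost z d K t w (s : time R) : R :=
  Num.min t (val s + K * Num.max 0 (d - dist_from z (w s))).

(* A continuous surrogate of the truncated exit time: staying at distance less
   than [d] is penalized instead of being forbidden. *)
Definition soft_exit z d K t w : R := inf (range (soft_cost z d K t w)).

Lemma soft_cost_ge0 z d K t w s : 0 <= K -> 0 <= t -> 0 <= soft_cost z d K t w s.
Proof.
move=> K0 t0; rewrite le_min t0 addr_ge0 ?time_ge0// mulr_ge0// le_max lexx//.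
Qed.

Lemma soft_cost_has_inf z d K t w : 0 <= K -> 0 <= t ->
  has_inf (range (soft_cost z d K t w)).
Proof.
move=> K0 t0; split; first by exists (soft_cost z d K t w (to_time 0)); exists (to_time 0).
by exists 0 => _ [s _ <-]; exact: soft_cost_ge0.
Qed.

Lemma soft_exit_le z d K t w s : 0 <= K -> 0 <= t ->
  soft_exit z d K t w <= soft_cost z d K t w s.
Proof.
move=> K0 t0; apply: ge_inf; last by exists s.
by case: (@soft_cost_has_inf z d K t w K0 t0).
Qed.

Lemma soft_exit_ge z d K t w x :
  (forall s, x <= soft_cost z d K t w s) -> x <= soft_exit z d K t w.
Proof.
move=> H; apply: lb_le_inf; last by move=> _ [s _ <-].
by exists (soft_cost z d K t w (to_time 0)); exists (to_time 0).
Qed.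

Lemma soft_exit_ge0 z d K t w : 0 <= K -> 0 <= t -> 0 <= soft_exit z d K t w.
Proof. by move=> K0 t0; apply: soft_exit_ge => s; exact: soft_cost_ge0. Qed.

Lemma soft_exit_le_cap z d K t w : 0 <= K -> 0 <= t -> soft_exit z d K t w <= t.
Proof.
move=> K0 t0; apply: (le_trans (soft_exit_le z d w (to_time 0) K0 t0)).
by rewrite ge_min lexx.
Qed.

Lemma soft_exit_le_exit z d K t w : 0 <= K -> 0 <= t ->
  ((soft_exit z d K t w)%:E <= mine (exit z d w) t%:E)%E.
Proof.
move=> K0 t0; rewrite le_min lee_fin soft_exit_le_cap// andbT.
apply: le_ereal_inf_tmp => _ [s /= sd <-]; rewrite lee_fin.
apply: (le_trans (soft_exit_le z d w s K0 t0)).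
by rewrite ge_min /soft_cost sd subrr maxxx mulr0 addr0 lexx orbT.
Qed.

Lemma dist_IVT z d w (s : time R) : dist_from z (w (to_time 0)) <= d ->
  d <= dist_from z (w s) -> exists2 u : time R, val u <= val s & dist_from z (w u) = d.
Proof.
move=> d0 ds.
have cf := @continuous_path_fun _ _ _ w (@continuous_dist_from z).
have [|c] := IVT (time_ge0 s) (continuous_subspaceT cf) (v := d).
  by rewrite to_timeK ge_min d0/= le_max ds orbT.
rewrite in_itv/= => /andP[c0 cs] cd.
by exists (to_time c) => //; rewrite val_to_time.
Qed.

(** The slope [t / e] makes the penalty at least [t] as long as the distance is below [d - e], so
    stopping there is no better than the cap. Beyond that distance the path, having started inside,
    has already crossed the smaller sphere. *)
Lemma exit_le_soft_exit z d e t w : 0 < e -> 0 <= t ->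
  dist_from z (w (to_time 0)) <= d - e ->
  (mine (exit z (d - e) w) t%:E <= (soft_exit z d (t / e) t w)%:E)%E.
Proof.
move=> e0 t0 w0.
have m_fin : mine (exit z (d - e) w) t%:E \is a fin_num.
  rewrite ge0_fin_numE; last by rewrite le_min hitg_ge0 lee_fin.
  by apply: (@le_lt_trans _ _ t%:E); rewrite ?ltry// ge_min lexx orbT.
rewrite -(fineK m_fin) lee_fin; apply: soft_exit_ge => s.
rewrite -lee_fin fineK// /soft_cost.
have [ds|ds] := leP (d - e) (dist_from z (w s)).
  have [u us ud] := dist_IVT w0 ds.
  rewrite EFin_min le_min ge_min lexx orbT/= ge_min; apply/orP; left.
  apply: (le_trans (hitg_lb ud)); rewrite lee_fin (le_trans us)//.
  by rewrite lerDl mulr_ge0 ?divr_ge0 ?(ltW e0)// le_max lexx.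
rewrite ge_min; apply/orP; right; rewrite lee_fin le_min lexx/=.
rewrite -[leLHS]add0r lerD ?time_ge0//.
rewrite -[leLHS](@divfK _ e) ?gt_eqF// ler_wpM2l ?divr_ge0 ?(ltW e0)//.
by rewrite le_max; apply/orP; right; move: ds; lra.
Qed.

(** Closeness up to time [t] is enough: any later time costs exactly the cap [t], for both paths.
    This matches the topology of uniform convergence on compact sets of times. *)
Lemma soft_exit_lip z d K t w w' (e : R) : 0 <= K -> 0 <= t -> 0 <= e ->
  (forall s, val s <= t -> `|val (w s) - val (w' s)| <= e) ->
  soft_exit z d K t w - K * e <= soft_exit z d K t w'.
Proof.
move=> K0 t0 e0 H; apply: soft_exit_ge => s.
rewrite lerBlDr (le_trans (soft_exit_le z d w s K0 t0))// /soft_cost.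
have Ke : 0 <= K * e by rewrite mulr_ge0.
have [st|ts] := leP (val s) t.
  have : K * Num.max 0 (d - dist_from z (w s)) <=
         K * Num.max 0 (d - dist_from z (w' s)) + K * e.
    rewrite -mulrDr ler_wpM2l// ge_max addr_ge0 ?le_max ?lexx//=.
    have : dist_from z (w' s) <= dist_from z (w s) + e.
      rewrite (le_trans _ (lerD (lexx _) (H s st)))//.
      have -> : dist_from z (w' s) = `|(val (w s) - z) - (val (w s) - val (w' s))|.
        by rewrite /dist_from; congr (`|_|); lra.
      exact: ler_normB.
    have : d - dist_from z (w' s) <= Num.max 0 (d - dist_from z (w' s)).
      by rewrite le_max lexx orbT.
    lra.
  move=> h; rewrite addr_minl le_min !ge_min lerDl Ke/=; apply/orP; right; lra.
have s0 w0 : t <= val s + K * Num.max 0 (d - dist_from z (w0 s)).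
  by rewrite (le_trans (ltW ts))// lerDl mulr_ge0// le_max lexx.
by rewrite (min_idPl (s0 w)) (min_idPl (s0 w')) lerDl.
Qed.

Lemma compact_time (t : R) : compact [set s : time R | val s <= t].
Proof.
have [t0|t0] := ltP t 0.
  rewrite (_ : [set _ | _] = set0); first exact: compact0.
  by apply/seteqP; split=> // s /= /(le_trans (time_ge0 s)); rewrite leNgt t0.
rewrite (_ : [set _ | _] = @to_time R @` `[0, t]).
  apply: continuous_compact; last exact: segment_compact.
  by apply: continuous_subspaceT; exact: continuous_to_time.
apply/seteqP; split=> [s /= st|_ [u /= + <-]].
  by exists (val s); rewrite ?to_timeK//= in_itv/= time_ge0.
by rewrite in_itv/= => /andP[u0 ut]; rewrite ge_max t0.
Qed.

Lemma near_path w (t e : R) : 0 < e ->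
  \forall w' \near w, forall s, val s <= t ->
    `|val (w s) - val ((w' : Omega) s)| < e.
Proof.
move=> e0.
have := @fam_nbhs _ _ compact _ _
  (w : {family compact, time R -> state})
  (entourage_ball state (PosNum e0)) (@compact_time t).
move=> /(@initial_continuous _ _
  (fun w : Omega => (w : {family compact, time R -> state})) w) H.
have {}H : nbhs w [set w' : Omega | forall s, val s <= t -> ball (w s) e (w' s)].
  exact: H.
by apply: filterS H => w' H s st; exact: H.
Qed.

Lemma continuous_soft_exit z d K t : 0 <= K -> 0 <= t ->
  continuous (@soft_exit z d K t).
Proof.
move=> K0 t0 w; apply/(@cvgrPdist_le _ R^o _ _ (nbhs_filter (w : Omega))) => e e0.
(* [K + 1] in the denominator, since [K] may be zero. *)
have K1 : 0 < K + 1 by lra.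
have eK : 0 < e / (K + 1) by rewrite divr_gt0.
have Ke : K * (e / (K + 1)) <= e.
  by rewrite mulrCA -[leRHS]mulr1 ler_pM2l// ler_pdivrMr// mul1r lerDl.
near=> w'.
have H : forall s, val s <= t -> `|val (w s) - val ((w' : Omega) s)| < e / (K + 1).
  by near: w'; exact: near_path.
have h1 := @soft_exit_lip z d K t w w' (e / (K + 1)) K0 t0 (ltW eK)
  (fun s st => ltW (H s st)).
have H' s : val s <= t -> `|val (w' s) - val (w s)| <= e / (K + 1).
  by move=> st; rewrite distrC ltW// H.
have h2 := @soft_exit_lip z d K t w' w (e / (K + 1)) K0 t0 (ltW eK) H'.
by rewrite ler_norml; apply/andP; split; lra.
Unshelve. all: by end_near. Qed.

Lemma continuous_cost (T : topologicalType) (K t d : R) (a b : T -> R) : 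
  continuous a -> continuous b -> continuous (fun x => Num.min t (a x + K * Num.max 0 (d - b x))).
Proof.
move=> ca cb x.
apply: (@continuous_min R T (cst t) (fun x => a x + K * Num.max 0 (d - b x))).
  exact: cst_continuous.
apply: (@continuousD R R^o T a (fun x => K * Num.max 0 (d - b x))); first exact: ca.
apply: (@continuousM R T (cst K) (fun x => Num.max 0 (d - b x))); first exact: cst_continuous.
apply: (@continuous_max R T (cst 0) (fun x => d - b x)); first exact: cst_continuous.
by apply: (@continuousB R R^o T (cst d) b); [exact: cst_continuous|exact: cb].
Qed.

Lemma measurable_soft_exit z d K t : 0 <= K -> 0 <= t ->
  measurable_fun setT (@soft_exit z d K t).
Proof.
move=> K0 t0; apply: (measurability _ (RGenInftyO.measurableE R)).
move=> _ [_ [r ->] <-]; rewrite setTI.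
have [tr|rt] := ltP t r.
  rewrite (_ : _ @^-1` _ = setT)//; apply/seteqP; split=> // w _ /=.
  by rewrite in_itv/= (le_lt_trans _ tr)// soft_exit_le_cap.
pose cost (q : rat) (x : state) := Num.min t (val (rat_time t q) +
  K * Num.max 0 (d - dist_from z x)).
have -> : soft_exit z d K t @^-1` `]-oo, r[ =
    \bigcup_q [set w : Omega | [set x | cost q x < r] (w (rat_time t q))].
  apply/seteqP; split=> w /=; rewrite in_itv/=; last first.
    by move=> [q _ /= qr]; exact: le_lt_trans (soft_exit_le _ _ _ _ K0 t0) qr.
  move=> /(inf_lt (soft_cost_has_inf z d w K0 t0).1)[_ [s _ <-]] sr.
  have st : val s <= t.
    rewrite leNgt; apply/negP => ts; move: sr; rewrite ltNge => /negP; apply.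
    rewrite (le_trans rt)// le_min lexx/= (le_trans (ltW ts))// lerDl.
    by rewrite mulr_ge0// le_max lexx.
  pose f (u : R) : R := Num.min t (u + K * Num.max 0 (d - dist_from z (w (to_time u)))).
  have cf : continuous f.
    apply: continuous_cost => u; first exact: cvg_id.
    exact: (@continuous_path_fun _ _ _ w (@continuous_dist_from z)).
  have [|q] := @rat_time_dense _ f t r s cf st; first by rewrite /f to_timeK.
  by rewrite /f to_timeK => qr; exists q.
apply: bigcupT_measurable_rat => q.
apply: (@Ft_measurable _ _ t); apply: Ft_coordinate; first exact: val_rat_time.
apply: open_measurable_state.
have co : continuous (cost q).
  by apply: continuous_cost; [exact: cst_continuous|exact: continuous_dist_from].
move/continuousP : co => co.
rewrite (_ : [set x | _] = cost q @^-1` `]-oo, r[).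
  by apply: co; exact: interval_open.
by apply/seteqP; split=> x /=; rewrite in_itv.
Qed.

End exit.

(** * The Markov property and expected exit times *)

Section markov.
Variables (R : realType) (J : nd_interval R).
Local Notation state := (state J).
Local Notation Omega := (path_space J).
Implicit Types (w : Omega) (z d K t : R) (P : state -> probability Omega R).

Lemma measurable_coordinate (s : time R) : measurable_fun setT (@coordinate R J s).
Proof.
move=> _ B mB; apply: (@Ft_measurable _ _ (val s)); rewrite setTI.
exact: Ft_coordinate.
Qed.

Lemma measurable_path_shift (s : time R) : measurable_fun setT (@path_shift R J s).
Proof.
apply: (measurability (\bigcup_(t in [set: time R])
  preimage_set_system setT (@coordinate R J t) measurable)) => //.
move=> _ [_ [u _ [B mB <-]] <-]; rewrite !setTI.
have -> : path_shift s @^-1` (coordinate u @^-1` B) =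
   setT `&` coordinate (time_add s u) @^-1` B by rewrite setTI.
exact: measurable_coordinate.
Qed.

Lemma start_measurable (x : state) : measurable [set w : Omega | coordinate (to_time 0) w = x].
Proof.
have -> : [set w : Omega | coordinate (to_time 0) w = x] =
    setT `&` coordinate (to_time 0) @^-1` (val @^-1` [set val x]).
  by rewrite setTI; apply/seteqP; split=> w /= [wx]; [rewrite wx|exact: val_inj].
apply: measurable_coordinate => //; apply: closed_measurable_state.
apply: closed_comp; last exact: closed_eq.
by move=> ? _; exact: continuous_state_val.
Qed.

Lemma start_ae (mu : probability Omega R) (x : state) :
  mu [set w : Omega | coordinate (to_time 0) w = x] = 1%E ->
  {ae mu, forall w, coordinate (to_time 0) w = x}.
Proof.
move=> mu1; exists (~` [set w : Omega | coordinate (to_time 0) w = x]); split => //.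
  by apply: measurableC; exact: start_measurable.
by rewrite probability_setC ?mu1 ?subee//; exact: start_measurable.
Qed.

Lemma stopping_time_cst t : 0 <= t -> stopping_time (fun _ : Omega => t%:E).
Proof.
move=> t0; split=> [w|s s0 u su]; first by rewrite lee_fin.
have [ts|st] := leP t s.
  rewrite (_ : [set _ | _] = ~` set0); first by apply: Ft_setC; exact: Ft_set0.
  by apply/seteqP; split=> // w _ /=; rewrite ?lee_fin.
rewrite (_ : [set _ | _] = set0); first exact: Ft_set0.
by apply/seteqP; split=> // w /=; rewrite ?lee_fin leNgt st.
Qed.

Lemma Ftau_plus_cst t (C : set Omega) : Ft t C -> Ftau_plus (fun _ => t%:E) C.
Proof.
move=> FC; split=> [|s s0 u su]; first exact: Ft_measurable FC.
have [ts|st] := leP t s.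
  rewrite (_ : _ `&` _ = C); first by apply: Ft_mono FC; lra.
  by apply/seteqP; split=> [w []//|w Cw /=]; split=> //; rewrite ?lee_fin.
rewrite (_ : _ `&` _ = set0); first exact: Ft_set0.
by apply/seteqP; split=> // w /= []; rewrite ?lee_fin leNgt st.
Qed.

Lemma simple_Markov P t x (C A : set Omega) : diffusion P -> 0 <= t -> Ft t C ->
  measurable A ->
  P x (path_shift (to_time t) @^-1` A `&` C) =
  (\int[P x]_(w in C) P (coordinate (to_time t) w) A)%E.
Proof.
move=> [_ _ sM] t0 FC mA.
have [_ /(_ C (Ftau_plus_cst FC))] := sM _ (stopping_time_cst t0) x A mA.
rewrite (_ : [set w | (t%:E < +oo)%E] = setT) ?setIT; last first.
  by apply/seteqP; split=> // w _ /=; rewrite ltry.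
by rewrite setIC.
Qed.

Lemma measurable_transition P (s : time R) (A : set Omega) : diffusion P ->
  measurable A -> measurable_fun setT (fun w : Omega => P (coordinate s w) A).
Proof.
move=> [mP _ _] mA.
exact: (measurableT_comp (mP A mA) (@measurable_coordinate s)).
Qed.

Import HBNNSimple.

Lemma simple_Markov_nnsfun P t x (C : set Omega) (h : {nnsfun Omega >-> R}) :
  diffusion P -> 0 <= t -> Ft t C ->
  (\int[P x]_(w in C) (h (path_shift (to_time t) w))%:E =
   \int[P x]_(w in C) \int[P (coordinate (to_time t) w)]_v (h v)%:E)%E.
Proof.
move=> dP t0 FC; have mC := Ft_measurable FC.
under [RHS]eq_integral do rewrite integralT_nnsfun sintegralE.
have hE v : h v = \sum_(r \in range h) (r * \1_(h @^-1` [set r]) v) by exact: fimfunE.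
under [LHS]eq_integral => w _ do rewrite hE -fsumEFin//.
rewrite !ge0_integral_fsum//; last 4 first.
- move=> r; apply: measurable_funeM; apply: measurable_funTS.
  exact: measurable_transition.
- by move=> r w _; exact: nnsfun_mulemu_ge0.
- move=> r; apply/measurable_EFinP; apply: measurable_funM => //.
  apply: measurable_funTS; apply: (measurableT_comp _ (@measurable_path_shift _)).
  exact: measurable_indic.
- by move=> r w _; rewrite EFinM nnfun_muleindic_ge0.
apply: eq_fsbigr => r; rewrite inE => -[v _ <-].
rewrite ge0_integralZl_EFin//; last first.
  by apply: measurable_funTS; exact: measurable_transition.
under eq_integral do rewrite EFinM.
rewrite ge0_integralZl_EFin//; last first.
  apply/measurable_EFinP.
  apply: measurable_funTS; apply: (measurableT_comp _ (@measurable_path_shift _)).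
  exact: measurable_indic.
congr (_ * _)%E.
rewrite -simple_Markov// -integral_indic//; last first.
  by rewrite -[X in measurable X]setTI; exact: measurable_path_shift.
Qed.

(** Stated as a bound by a constant [M], so that measurability of the inner expectation in the
    starting point is needed only for simple functions, where it is a finite sum of transition
    probabilities. Monotone convergence does the rest. *)
Lemma simple_Markov_le P t x (C : set Omega) (F : Omega -> \bar R) (M : \bar R) :
  diffusion P -> 0 <= t -> Ft t C ->
  measurable_fun setT F -> (forall w, 0 <= F w)%E ->
  (forall w, C w -> \int[P (coordinate (to_time t) w)]_v F v <= M)%E ->
  (\int[P x]_(w in C) F (path_shift (to_time t) w) <= M * P x C)%E.
Proof.
move=> dP t0 FC mF F0 HM; have mC := Ft_measurable FC.
pose h := nnsfun_approx measurableT mF.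
have hF k w : ((h k w)%:E <= F w)%E.
  have hw : EFin \o h^~ w @ \oo --> F w by exact: cvg_nnsfun_approx.
  rewrite -(cvg_lim _ hw)//; apply: lime_ge; first by apply/cvg_ex; exists (F w).
  by exists k => // j /= kj; rewrite lee_fin; exact/lefP/nd_nnsfun_approx.
have -> : (\int[P x]_(w in C) F (path_shift (to_time t) w) =
  \int[P x]_(w in C) limn (fun k => (h k (path_shift (to_time t) w))%:E))%E.
  by apply: eq_integral => w _; apply/esym/cvg_lim => //; exact: cvg_nnsfun_approx.
rewrite monotone_convergence//; last 3 first.
- move=> k; apply/measurable_EFinP; apply: measurable_funTS.
  exact: (measurableT_comp _ (@measurable_path_shift _)).
- by move=> k w _; rewrite lee_fin.
- by move=> w _ a b ab; rewrite lee_fin; exact/lefP/nd_nnsfun_approx.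
apply: lime_le.
  apply: ereal_nondecreasing_is_cvgn => a b ab; apply: ge0_le_integral => //.
  - by move=> w _; rewrite lee_fin.
  - apply/measurable_EFinP; apply: measurable_funTS.
    exact: (measurableT_comp _ (@measurable_path_shift _)).
  - apply/measurable_EFinP; apply: measurable_funTS.
    exact: (measurableT_comp _ (@measurable_path_shift _)).
  - by move=> w _; rewrite lee_fin; exact/lefP/nd_nnsfun_approx.
apply: nearW => k; rewrite simple_Markov_nnsfun//.
rewrite -integral_cst//; apply: ge0_le_integral => //.
- by move=> w _; apply: integral_ge0 => v _; rewrite lee_fin.
- rewrite (_ : (fun w => _) = (fun w => \sum_(r \in range (h k))
      r%:E * P (coordinate (to_time t) w) (h k @^-1` [set r]))%E); last first.
    by apply/funext => w; rewrite integralT_nnsfun sintegralE.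
  apply: emeasurable_fsum => // r; apply: measurable_funeM; apply: measurable_funTS.
  exact: measurable_transition.
move=> w Cw; apply: le_trans (HM _ Cw); apply: ge0_le_integral => //.
- by move=> v _; rewrite lee_fin.
- exact/measurable_EFinP.
Qed.

End markov.

(** * Exit times under weak convergence and under restarts *)

Section exit_times.
Variables (R : realType) (J : nd_interval R).
Local Notation state := (state J).
Local Notation Omega := (path_space J).
Implicit Types (w : Omega) (z d t : R) (P : state -> probability Omega R).
Implicit Types (mu : probability Omega R).
Local Open Scope ereal_scope.

Definition starts_at mu (x : state) :=
  mu [set w : Omega | coordinate (to_time 0) w = x] = 1.

Lemma cvg_mine_nat (x : \bar R) : 0 <= x ->
  mine x k%:R%:E @[k --> \oo] --> x.
Proof.
case: x => [r r0|_|//].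
  apply: cvg_near_cst.
  near=> k; apply/eqP; rewrite minEle; case: ifPn => //; rewrite -ltNge lte_fin => kr.
  suff : (r <= k%:R)%R by rewrite leNgt kr.
  by near: k; exact: nbhs_infty_ger.
under eq_fun do rewrite min_r ?leey//.
by apply/cvgeryP; exact: cvgr_idn.
Unshelve. all: by end_near. Qed.

Lemma measurable_exit z d : measurable_fun setT (@exit R J z d).
Proof. exact: measurable_hitg (@continuous_dist_from _ _ z). Qed.

Lemma measurable_exit_cap z d (N : \bar R) :
  measurable_fun setT (fun w : Omega => mine (exit z d w) N).
Proof. by apply: measurable_mine => //; exact: measurable_exit. Qed.

Lemma exit_ge0 z d w : 0 <= exit z d w.
Proof. exact: hitg_ge0. Qed.

Lemma integral_exit_cap_cvg mu z d :
  \int[mu]_w mine (exit z d w) k%:R%:E @[k --> \oo] --> \int[mu]_w exit z d w.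
Proof.
have -> : \int[mu]_w exit z d w = \int[mu]_w limn (fun k => mine (exit z d w) k%:R%:E).
  apply: eq_integral => w _; apply/esym/cvg_lim => //.
  by apply: cvg_mine_nat; exact: exit_ge0.
apply: cvg_monotone_convergence => //.
- by move=> k; exact: measurable_exit_cap.
- by move=> k w _; rewrite le_min exit_ge0 lee_fin ler0n.
- by move=> w _ a b ab; rewrite le_min !ge_min lexx/= lee_fin ler_nat ab orbT.
Qed.

(** [L] is the expectation of the soft exit time under the limit law; the number hides the surrogate
    and keeps only the two bounds that it transports. *)
Lemma weak_cvg_exit (mu_ : nat -> probability Omega R) mu (x : state) z d e t :
  weak_cvg mu_ mu -> (forall n, starts_at (mu_ n) x) -> starts_at mu x ->
  (0 < e)%R -> (0 <= t)%R -> (dist_from z x <= d - e)%R ->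
  exists L : R, [/\ \int[mu]_w mine (exit z (d - e) w) t%:E <= L%:E,
    L%:E <= \int[mu]_w mine (exit z d w) t%:E &
    forall eta : R, (0 < eta)%R -> \forall n \near \oo,
      (L - eta)%:E <= \int[mu_ n]_w mine (exit z d w) t%:E /\
      \int[mu_ n]_w mine (exit z (d - e) w) t%:E <= (L + eta)%:E].
Proof.
move=> mu_mu mu_x mux e0 t0 xd.
have te0 : (0 <= t / e)%R by rewrite divr_ge0// ltW.
pose Phi : Omega -> R := soft_exit z d (t / e) t.
have mPhi : measurable_fun setT (EFin \o Phi).
  by apply/measurable_EFinP; exact: measurable_soft_exit.
have Phi0 w : 0 <= (Phi w)%:E by rewrite lee_fin; exact: soft_exit_ge0.
have upper (nu : probability Omega R) :
    \int[nu]_w (Phi w)%:E <= \int[nu]_w mine (exit z d w) t%:E.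
  apply: ge0_le_integral => //; first exact: measurable_exit_cap.
  by move=> w _; exact: soft_exit_le_exit.
have lower (nu : probability Omega R) : starts_at nu x ->
    \int[nu]_w mine (exit z (d - e) w) t%:E <= \int[nu]_w (Phi w)%:E.
  move=> nux; apply: ae_ge0_le_integral => //.
  - by move=> w _; rewrite le_min exit_ge0 lee_fin.
  - exact: measurable_exit_cap.
  apply: filterS (start_ae nux) => w wx _.
  by apply: exit_le_soft_exit => //; rewrite -[w _]/(coordinate _ w) wx.
have fin (nu : probability Omega R) : \int[nu]_w (Phi w)%:E \is a fin_num.
  rewrite ge0_fin_numE; last exact: integral_ge0.
  apply: (@le_lt_trans _ _ (\int[nu]_w (cst t%:E) w)).
    apply: ge0_le_integral => //.
    by move=> w _; rewrite lee_fin; exact: soft_exit_le_cap.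
  rewrite integral_cst// [X in _ * X](_ : _ = 1) ?mule1 ?ltry//.
  exact: probability_setT.
exists (fine (\int[mu]_w (Phi w)%:E)); rewrite fineK//; split; [exact: lower|exact: upper|].
move=> eta eta0.
have := mu_mu Phi (continuous_soft_exit te0 t0).
have bPhi : bounded_fun (Phi : Omega -> R^o).
  exists t; split; first exact: num_real.
  move=> y ty w _ /=; rewrite ger0_norm; last exact: soft_exit_ge0.
  by apply: le_trans (ltW ty); exact: soft_exit_le_cap.
move=> /(_ bPhi); rewrite -{1}(fineK (fin mu)) => /fine_cvgP[_].
move=> /cvgrPdist_le /(_ _ eta0); apply: filterS => n /=.
rewrite ler_distl => /andP[h1 h2]; split.
  apply: le_trans (upper _); rewrite -(fineK (fin (mu_ n))) lee_fin; lra.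
apply: le_trans (lower _ (mu_x n)) _; rewrite -(fineK (fin (mu_ n))) lee_fin; lra.
Qed.

(** A Fatou-type bound: some truncation already has expectation above [M] under the limit, and
    dropping the truncation for large n only helps. An infinite limiting expectation is allowed. *)
Lemma exit_integral_liminf (mu_ : nat -> probability Omega R) mu (x : state) z d e (M : R) :
  weak_cvg mu_ mu -> (forall n, starts_at (mu_ n) x) -> starts_at mu x ->
  (0 < e)%R -> (dist_from z x <= d - e)%R ->
  M%:E < \int[mu]_w exit z (d - e) w ->
  \forall n \near \oo, M%:E < \int[mu_ n]_w exit z d w.
Proof.
move=> mu_mu mu_x mux e0 xd Mlt.
have [k kM] : exists k : nat, M%:E < \int[mu]_w mine (exit z (d - e) w) k%:R%:E.
  apply/not_existsP => H; move: Mlt; rewrite ltNge => /negP; apply.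
  have /cvg_lim <- // := @integral_exit_cap_cvg mu z (d - e).
  apply: lime_le; first by apply/cvg_ex; exists (\int[mu]_w exit z (d - e) w);
    exact: integral_exit_cap_cvg.
  by apply: nearW => k; rewrite leNgt; apply/negP/H.
have [L [h1 _ h3]] := weak_cvg_exit mu_mu mu_x mux e0 (ler0n R k) xd.
have ML : (M < L)%R by rewrite -lte_fin (lt_le_trans kM).
have : (0 < (L - M) / 2)%R by lra.
move=> /h3; apply: filterS => n [+ _] => h.
apply: (@lt_le_trans _ _ (L - (L - M) / 2)%:E); first by rewrite lte_fin; lra.
apply: (le_trans h); apply: ge0_le_integral => //.
- by move=> w _; rewrite le_min exit_ge0 lee_fin ler0n.
- exact: measurable_exit_cap.
- exact: measurable_exit.
- by move=> w _; rewrite ge_min lexx.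
Qed.

(** Markov's inequality for the truncated exit time, which equals [t] on this event. *)
Lemma exit_tail_le mu z d t : (0 <= t)%R ->
  t%:E * mu [set w | t%:E < exit z d w] <= \int[mu]_w mine (exit z d w) t%:E.
Proof.
move=> t0.
have mA : measurable [set w : Omega | t%:E < exit z d w].
  rewrite -[X in measurable X]setTI; apply: emeasurable_fun_o_infty => //.
  exact: measurable_exit.
rewrite -integral_cst//.
apply: (@le_trans _ _ (\int[mu]_(w in [set w | t%:E < exit z d w]) mine (exit z d w) t%:E)).
  apply: ge0_le_integral => //.
  - apply: measurable_funTS; exact: measurable_exit_cap.
  - by move=> w /= /ltW tw; rewrite min_r.
apply: ge0_subset_integral => //; first exact: measurable_exit_cap.
by move=> w _; rewrite le_min exit_ge0 lee_fin.
Qed.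

Lemma exit_shift z d w t : (0 <= t)%R -> (dist_from z (w (to_time 0)) <= d)%R ->
  t%:E < exit z d w ->
  (dist_from z (w (to_time t)) < d)%R /\
  exit z d w <= t%:E + exit z d (path_shift (to_time t) w).
Proof.
move=> t0 w0 tw; split.
  rewrite ltNge; apply/negP => dt.
  have [u ut ud] := dist_IVT w0 dt.
  move: tw; rewrite ltNge => /negP; apply.
  by apply: (le_trans (hitg_lb ud)); rewrite lee_fin (le_trans ut)// val_to_time.
rewrite -leeBlDl//; apply: le_ereal_inf_tmp => _ [s sd <-].
rewrite leeBlDl// -[t in t%:E](val_to_time t0) -EFinD -val_time_add.
exact: (@hitg_lb R J (dist_from z) d w (time_add (to_time t) s) sd).
Qed.

(** Time beyond [t] is spent only on the event that the path is still inside at [t], and from there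
    it costs at most [M] on average. The cap [N] may be finite, as in the induction for geometric
    tails, or [+oo], as in the final absorption. *)
Lemma exit_Markov P (x : state) z d t (N M : \bar R) : diffusion P ->
  (0 <= t)%R -> (dist_from z x <= d)%R -> 0 <= N -> 0 <= M ->
  (forall y : state, (dist_from z y < d)%R ->
     \int[P y]_w mine (exit z d w) N <= M) ->
  \int[P x]_w mine (exit z d w) (t%:E + N) <=
  \int[P x]_w mine (exit z d w) t%:E + M * P x [set w | t%:E < exit z d w].
Proof.
move=> dP t0 xd N0 M0 HM.
have Px : starts_at (P x) x by case: dP => _ + _; apply.
pose A : set Omega := [set w | t%:E < exit z d w].
(* Almost surely under [P x] the second condition follows from the first, but [simple_Markov_le]
   asks for the bound at every path of the event. *)
pose C : set Omega := A `&` [set w | (dist_from z (w (to_time t)) < d)%R].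
have FA : Ft t A.
  have -> : A = ~` [set w | exit z d w <= t%:E].
    by rewrite /A; apply/seteqP; split=> w /=; rewrite ltNge => /negP.
  by apply: Ft_setC; apply: Ft_hitg; exact: continuous_dist_from.
have FC : Ft t C.
  apply: Ft_setI => //.
  apply: (@Ft_coordinate _ _ (to_time t) t [set y | dist_from z y < d]%R).
    by rewrite val_to_time.
  apply: open_measurable_state.
  rewrite (_ : [set y | _] = dist_from z @^-1` (`]-oo, d[%classic : set R)); last first.
    by apply/seteqP; split=> y /=; rewrite in_itv.
  have /continuousP := @continuous_dist_from R J z; apply; exact: interval_open.
have mA := Ft_measurable FA; have mC := Ft_measurable FC.
pose F w := mine (exit z d w) N.
have F0 w : 0 <= F w by rewrite le_min exit_ge0.
have mF : measurable_fun setT F by exact: measurable_exit_cap.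
pose G := (fun w => F (path_shift (to_time t) w)) \_ C.
have G0 w : 0 <= G w by rewrite /G /patch; case: ifP.
have mG : measurable_fun setT G.
  apply/(measurable_restrictT _ mC); apply: measurable_funTS.
  exact: (measurableT_comp mF (@measurable_path_shift _ _ _)).
have m0 w : 0 <= mine (exit z d w) t%:E by rewrite le_min exit_ge0 lee_fin.
apply: (@le_trans _ _ (\int[P x]_w (mine (exit z d w) t%:E + G w))).
  apply: ae_ge0_le_integral => //.
  - by move=> w _; rewrite le_min exit_ge0 adde_ge0.
  - exact: measurable_exit_cap.
  - by move=> w _; rewrite adde_ge0.
  - by apply: emeasurable_funD => //; exact: measurable_exit_cap.
  apply: filterS (start_ae Px) => w wx _.
  have w0 : (dist_from z (w (to_time 0)) <= d)%R by rewrite -[w _]/(coordinate _ w) wx.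
  have [wt|tw] := leP (exit z d w) t%:E.
    by rewrite ge_min (@le_trans _ _ (exit z d w))// leeDl.
  have [wd shift] := exit_shift t0 w0 tw.
  rewrite /G patchT ?inE// /F.
  have [_|_] := leP (exit z d (path_shift (to_time t) w)) N.
    by rewrite ge_min shift.
  by rewrite ge_min lexx orbT.
rewrite ge0_integralD//; last exact: measurable_exit_cap.
apply: leeD => //; rewrite -integral_mkcond.
apply: (le_trans (@simple_Markov_le _ _ P t x C F M dP t0 FC mF F0 _)).
  by move=> w [_ /= wd]; exact: HM.
by apply: lee_wpmul2l => //; apply: le_measure; rewrite ?inE// => w [].
Qed.

End exit_times.

(** * Exit times from balls around an endpoint *)

Section exit_convergence.
Variables (R : realType) (J : nd_interval R).
Local Notation state := (state J).
Local Notation Omega := (path_space J).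
Implicit Types (w : Omega) (z d t : R) (P : state -> probability Omega R).
Implicit Types (x y : state).
Local Open Scope ereal_scope.

Definition endpoint x := is_left_end x \/ is_right_end x.

Lemma endpoint_dist_inj x y y' : endpoint x ->
  dist_from (val x) y = dist_from (val x) y' -> y = y'.
Proof.
move=> [] ex; rewrite /dist_from => dd; apply: val_inj.
  by move: dd; rewrite !ger0_norm ?subr_ge0//; exact: addIr.
by move: dd; rewrite !ler0_norm ?subr_le0// => /oppr_inj/addIr.
Qed.

Lemma dist_from_start x : dist_from (val x) x = 0%R.
Proof. by rewrite /dist_from subrr normr0. Qed.

Lemma measurable_exit_gt z d t : measurable [set w : Omega | t%:E < exit z d w].
Proof.
rewrite -[X in measurable X]setTI; apply: emeasurable_fun_o_infty => //.
exact: measurable_exit.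
Qed.

(* The path must pass through [y] before it gets further away from the endpoint. *)
Lemma endpoint_exit_comparison P x y d t : diffusion P -> endpoint x ->
  (0 <= t)%R -> (dist_from (val x) y < d)%R ->
  P x [set w | exit (val x) d w <= t%:E] <= P y [set w | exit (val x) d w <= t%:E].
Proof.
move=> dP ex t0 yd; set z : R := val x; set A := [set w | exit z d w <= t%:E].
have Px : starts_at (P x) x by case: dP => _ + _; apply.
pose c := dist_from z y.
pose tau : Omega -> \bar R := exit z c.
have c0 : (0 <= c)%R by rewrite /c /dist_from.
(* The intermediate value theorem needs the start at [x], so everything is restricted to this event
   of full measure. *)
pose C : set Omega := [set w | coordinate (to_time 0) w = x].
have mC : measurable C by exact: start_measurable.
have cz : continuous (dist_from z : state -> R) by exact: continuous_dist_from.
have mA : measurable A by apply: (@Ft_measurable _ _ t); exact: Ft_hitg.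
have sing (v : state) : measurable [set v].
  rewrite (_ : [set v] = setT `&` val @^-1` [set val v]).
    by apply: continuous_measurable_state => //; exact: continuous_state_val.
  by rewrite setTI; apply/seteqP; split=> u; [move=> ->|exact: val_inj].
have FC : Ftau_plus tau C.
  split=> // s s0 u su; apply: Ft_setI.
    by apply: (@Ft_coordinate _ _ (to_time 0) u [set x]) => //; rewrite val_to_time//; lra.
  by apply: (@Ft_mono _ _ s); [exact: ltW|exact: Ft_hitg].
have st_tau : stopping_time tau by exact: stopping_time_hitg.
case: dP => _ _ /(_ tau st_tau x A mA)[_ /(_ C FC)].
set S := _ `&` _ `&` _ => PS.
(* From an endpoint the distance determines the point, so at time [tau] the path is at [y]
   itself. *)
have tau_attained w : tau w < +oo -> exists u : time R,
    [/\ tau w = (val u)%:E, to_time (fine (tau w)) = u & w u = y].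
  move=> wy.
  have taufin : tau w = (fine (tau w))%:E.
    by rewrite fineK// ge0_fin_numE// exit_ge0.
  have /(hitg_leP _ _ _ cz)[u uf wu] : hitg (dist_from z) c w <= (fine (tau w))%:E.
    by rewrite -taufin.
  have fu : fine (tau w) = val u.
    by apply/le_anti; rewrite uf andbT -lee_fin -taufin; exact: hitg_lb.
  by exists u; rewrite taufin /= fu to_timeK; split=> //; exact: (endpoint_dist_inj ex).
(* Undoing the shift exhibits [S] as a measurable event. The path cannot be at distance [d] before
   [tau], because it meets distance [c < d] first. *)
have S_alt : S = C `&` [set w | tau w < +oo] `&` [set w | exit z d w <= tau w + t%:E].
  apply/seteqP; split=> w [[wx wtau] wA]; split=> //;
    have [u [tauu fu wu]] := tau_attained w wtau.
    move: wA; rewrite /path_shift_at /= fu => /hitg_leP[//|s st sd].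
    rewrite tauu; apply: (le_trans (@hitg_lb _ _ _ _ _ (time_add u s) sd)).
    by rewrite val_time_add -EFinD lee_fin lerD2l.
  move: wA; rewrite /= tauu -EFinD => /hitg_leP[//|v vt vd].
  rewrite /path_shift_at /= fu; apply/hitg_leP => //.
  have uv : (val u <= val v)%R.
    have [v' v'v v'c] : exists2 v' : time R, (val v' <= val v)%R & dist_from z (w v') = c.
      apply: dist_IVT; last by rewrite vd ltW.
      by rewrite -[w _]/(coordinate _ w) wx dist_from_start.
    by apply: le_trans v'v; rewrite -lee_fin -tauu; exact: hitg_lb.
  exists (to_time (val v - val u)); first by rewrite val_to_time ?subr_ge0//; lra.
  rewrite -[LHS]/(dist_from z (w (time_add u (to_time (val v - val u))))).
  rewrite (_ : time_add u _ = v)//; apply: val_inj.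
  by rewrite val_time_add val_to_time ?subr_ge0// addrC subrK.
have mCt : measurable (C `&` [set w | tau w < +oo]).
  apply: measurableI => //; rewrite -[X in measurable X]setTI.
  by apply: emeasurable_fun_infty_o => //; exact: measurable_exit.
have mS : measurable S.
  rewrite S_alt; apply: measurableI => //; rewrite -[X in measurable X]setTI.
  apply: measurable_lee => //; first exact: measurable_exit.
  by apply: emeasurable_funD => //; exact: measurable_exit.
(* A path out by time [t] has passed [y] on its way, so [tau] is finite, and its exit time is at
   most [t <= tau + t]. *)
have AS : A `<=` S `|` ~` C.
  move=> w Aw; have [Cw|] := pselect (C w); last by right.
  left; rewrite S_alt; move: (Aw) => /hitg_leP[//|v vt vd].
  have [u uv uc] : exists2 u : time R, (val u <= val v)%R & dist_from z (w u) = c.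
    apply: dist_IVT; last by rewrite vd ltW.
    by rewrite -[w _]/(coordinate _ w) Cw dist_from_start.
  split; last by apply: (le_trans Aw); rewrite leeDr// exit_ge0.
  by split=> //; apply: (le_lt_trans (hitg_lb uc)); rewrite ltry.
have PC0 : P x (~` C) = 0 by rewrite probability_setC// Px subee.
apply: (@le_trans _ _ (P x S)).
  apply: (@le_trans _ _ (P x (S `|` ~` C))).
    by apply: le_measure => //; rewrite inE//; apply: measurableU => //; exact: measurableC.
  apply: (le_trans (measureU2 _ _ _)) => //; first exact: measurableC.
  by rewrite [X in _ + X](_ : _ = 0) ?adde0.
(* The integrand is the constant [P y A], as the path is at [y] at time [tau]. *)
rewrite PS (_ : \int[P x]_(w in _) _ =
    \int[P x]_(w in C `&` [set w | tau w < +oo]) cst (P y A) w).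
  rewrite integral_cst// -[leRHS]mule1; apply: lee_wpmul2l => //.
  exact: probability_le1.
apply: eq_integral => w; rewrite inE => -[_ /tau_attained[u [_ fu wu]]].
by rewrite /stopped fu /coordinate wu.
Qed.

(** The comparison extends the bound 1/2 on surviving a period [t] to every starting point of the
    ball, so the process can be restarted at multiples of [t]. The caps keep the induction
    meaningful before any expectation is known to be finite. *)
Lemma endpoint_exit_finite P x d t : diffusion P -> endpoint x -> (0 < t)%R ->
  (0 < d)%R ->
  P x [set w | t%:E < exit (val x) d w] <= (2^-1)%:E ->
  \int[P x]_w exit (val x) d w < +oo.
Proof.
move=> dP ex t0 d0 Px; set z := val x.
have exitC : [set w : Omega | t%:E < exit z d w] = ~` [set w | exit z d w <= t%:E].
  by apply/seteqP; split=> w /=; rewrite ltNge => /negP.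
have mA : measurable [set w : Omega | exit z d w <= t%:E].
  by apply: (@Ft_measurable _ _ t); apply: Ft_hitg; exact: continuous_dist_from.
have Py (y : state) : (dist_from z y < d)%R ->
    P y [set w | t%:E < exit z d w] <= (2^-1)%:E.
  move=> yd; apply: le_trans Px; rewrite exitC !probability_setC//.
  by apply: leeB => //; exact: endpoint_exit_comparison dP ex (ltW t0) yd.
(* [2 * t] is the fixed point of [M = t + M / 2], the recursion given by one restart. *)
have bound k (y : state) : (dist_from z y < d)%R ->
    \int[P y]_w mine (exit z d w) (k%:R * t)%:E <= (2 * t)%:E.
  elim: k y => [|k IH] y yd.
    rewrite (_ : \int[P y]_w _ = 0) ?lee_fin ?mulr_ge0 ?ler0n ?(ltW t0)//.
    by apply: integral0_eq => w _; rewrite mul0r min_r// exit_ge0.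
  have -> : (k.+1%:R * t)%:E = t%:E + (k%:R * t)%:E.
    by rewrite -EFinD -natr1 mulrDl mul1r addrC.
  apply: (le_trans (@exit_Markov _ _ P y z d t _ (2 * t)%:E dP (ltW t0) (ltW yd) _ _ IH)).
  - by rewrite lee_fin mulr_ge0 ?ler0n ?(ltW t0).
  - by rewrite lee_fin mulr_ge0 ?ler0n ?(ltW t0).
  rewrite [leRHS](_ : _ = t%:E + (2 * t)%:E * (2^-1)%:E); last first.
    by rewrite -EFinM -EFinD; congr (_%:E); lra.
  apply: leeD; last by apply: lee_wpmul2l; [rewrite lee_fin mulr_ge0 ?ler0n ?(ltW t0)|exact: Py].
  apply: (@le_trans _ _ (\int[P y]_w cst t%:E w)).
    apply: ge0_le_integral => //; first by move=> w _; rewrite le_min exit_ge0 lee_fin ltW.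
    - exact: measurable_exit_cap.
    by move=> w _; rewrite ge_min lexx orbT.
  rewrite integral_cst// -[leRHS]mule1; apply: lee_wpmul2l; first by rewrite lee_fin ltW.
  exact: probability_le1.
apply: (@le_lt_trans _ _ (2 * t)%:E); last exact: ltry.
have cvgx := @integral_exit_cap_cvg R J (P x) z d.
rewrite -(cvg_lim _ cvgx)//; apply: lime_le; first by apply/cvg_ex; eexists; exact: cvgx.
apply: nearW => m.
have [k mk] : exists k : nat, (m%:R <= k%:R * t)%R.
  exists (Num.truncn (m%:R / t)).+1; rewrite -ler_pdivrMr// ltW//.
  by have := truncnS_gt (m%:R / t).
have xd : (dist_from z x < d)%R by rewrite dist_from_start.
apply: le_trans (bound k x xd).
apply: ge0_le_integral => //; first by move=> w _; rewrite le_min exit_ge0 lee_fin ler0n.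
- exact: measurable_exit_cap.
- exact: measurable_exit_cap.
by move=> w _; rewrite le_min !ge_min lexx/= lee_fin mk orbT.
Qed.

End exit_convergence.

(** * Upper bounds for expected exit times along the sequence *)

Section exit_limits.
Variables (R : realType) (J : nd_interval R).
Local Notation state := (state J).
Local Notation Omega := (path_space J).
Implicit Types (w : Omega) (z d t : R).
Implicit Types (x y : state).
Variable P : nat -> state -> probability Omega R.
Hypothesis dP : forall n, diffusion (P n).
Local Open Scope ereal_scope.

Lemma exit_cap_limsup x d e t (eta : R) :
  weak_cvg (P ^~ x) (P 0%N x) ->
  (0 < d)%R -> (0 < e)%R -> (0 <= t)%R -> (0 < eta)%R ->
  \int[P 0%N x]_w exit (val x) (d + e) w < +oo ->
  \forall n \near \oo, \int[P n x]_w mine (exit (val x) d w) t%:E <=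
    (fine (\int[P 0%N x]_w exit (val x) (d + e) w) + eta)%:E.
Proof.
move=> P_x d0 e0 t0 eta0; set a := integral _ _ _ => afin.
have starts n : starts_at (P n x) x by case: (dP n) => _ + _; apply.
have xd : (dist_from (val x) x <= d + e - e)%R by rewrite dist_from_start addrK ltW.
have [L [_ L1 L2]] := weak_cvg_exit P_x starts (starts 0%N) e0 t0 xd.
have La : (L <= fine a)%R.
  rewrite -lee_fin fineK; last by rewrite ge0_fin_numE//; apply: integral_ge0 => *; exact: exit_ge0.
  apply: (le_trans L1); apply: ge0_le_integral => //.
  - by move=> w _; rewrite le_min exit_ge0 lee_fin.
  - exact: measurable_exit_cap.
  - exact: measurable_exit.
  - by move=> w _; rewrite ge_min lexx.
apply: filterS (L2 _ eta0) => n [_]; rewrite addrK => h.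
by apply: (le_trans h); rewrite lee_fin lerD2r.
Qed.

Lemma endpoint_exit_finite_near x d e :
  weak_cvg (P ^~ x) (P 0%N x) -> endpoint x -> (0 < d)%R -> (0 < e)%R ->
  \int[P 0%N x]_w exit (val x) (d + e) w < +oo ->
  \forall n \near \oo, \int[P n x]_w exit (val x) d w < +oo.
Proof.
move=> P_x ex d0 e0 afin.
set a := fine (\int[P 0%N x]_w exit (val x) (d + e) w).
have a0 : (0 <= a)%R by apply: fine_ge0; apply: integral_ge0 => *; exact: exit_ge0.
(* For large n the capped expectation is at most [a + 1]; with this cap Markov's inequality bounds
   the survival probability by 1/2. *)
have t0 : (0 < 2 * (a + 1))%R by rewrite mulr_gt0// ltr_wpDl.
apply: filterS (exit_cap_limsup P_x d0 e0 (ltW t0) ltr01 afin) => n capn.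
apply: (endpoint_exit_finite (dP n) ex t0 d0).
have := le_trans (exit_tail_le (P n x) (val x) d (ltW t0)) capn.
rewrite -/a EFinM -muleA -[leRHS]mul1e -[X in _ <= X]muleC.
set p := P n x _.
have pfin : p \is a fin_num by exact: fin_num_measure (measurable_exit_gt _ _ _).
rewrite -(fineK pfin) -!EFinM !lee_fin mulr1 mulrA mulrC.
have a1 : (0 < a + 1)%R by lra.
by rewrite mulrA -ler_pdivlMr// divff ?gt_eqF// => h; rewrite -div1r ler_pdivlMr// mulrC.
Qed.

(** A restart bounds E exit by its truncated version plus a small multiple of E exit itself; the
    assumed finiteness for large n lets this multiple be absorbed on the left. *)
Lemma exit_integral_limsup x d e (eta : R) :
  weak_cvg (P ^~ x) (P 0%N x) -> (0 < d)%R -> (0 < e)%R -> (0 < eta)%R ->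
  (forall n y, (dist_from (val x) y < d)%R ->
    \int[P n y]_w exit (val x) d w <= 2%:E * \int[P n x]_w exit (val x) d w) ->
  (\forall n \near \oo, \int[P n x]_w exit (val x) d w < +oo) ->
  \int[P 0%N x]_w exit (val x) (d + e) w < +oo ->
  \forall n \near \oo, \int[P n x]_w exit (val x) d w <=
    \int[P 0%N x]_w exit (val x) (d + e) w + eta%:E.
Proof.
move=> P_x d0 e0 eta0 comp finn afin.
have afn : \int[P 0%N x]_w exit (val x) (d + e) w \is a fin_num.
  by rewrite ge0_fin_numE//; apply: integral_ge0 => *; exact: exit_ge0.
set a := fine (\int[P 0%N x]_w exit (val x) (d + e) w).
have a0 : (0 <= a)%R by apply: fine_ge0; apply: integral_ge0 => *; exact: exit_ge0.
(* The restart after time [t] costs at most [2 * E exit * b / t], a fraction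
   [eta / (2 * (b + eta / 2))] of [E exit]. *)
have eta2 : (0 < eta / 2)%R by lra.
pose b := (a + eta / 2)%R; have b0 : (0 < b)%R by rewrite /b; lra.
pose t := (2 * b * (b + eta / 2) / (eta / 2))%R.
have t0 : (0 < t)%R by rewrite /t divr_gt0// mulr_gt0 ?mulr_gt0//; lra.
have capn := exit_cap_limsup P_x d0 e0 (ltW t0) eta2 afin.
apply: filterS2 finn capn => n rfin; rewrite -/a -/b => capn.
have r0 : 0 <= \int[P n x]_w exit (val x) d w.
  by apply: integral_ge0 => *; exact: exit_ge0.
have rfn : \int[P n x]_w exit (val x) d w \is a fin_num by rewrite ge0_fin_numE.
set r := fine (\int[P n x]_w exit (val x) d w).
have rE : \int[P n x]_w exit (val x) d w = r%:E by rewrite fineK.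
rewrite -(fineK afn) -/a rE -EFinD lee_fin.
have r0' : (0 <= r)%R by rewrite -lee_fin -rE.
have xd : (dist_from (val x) x <= d)%R by rewrite dist_from_start ltW.
have tail := le_trans (exit_tail_le (P n x) (val x) d (ltW t0)) capn.
have r2 : 0 <= (2 * r)%:E by rewrite lee_fin mulr_ge0.
have := @exit_Markov _ _ (P n) x (val x) d t +oo (2 * r)%:E (dP n) (ltW t0) xd (leey _) r2.
have -> : \int[P n x]_w mine (exit (val x) d w) (t%:E + +oo) = r%:E.
  by rewrite -rE; apply: eq_integral => w _; rewrite addey// min_l// leey.
have comp' y : (dist_from (val x) y < d)%R ->
    \int[P n y]_w mine (exit (val x) d w) +oo <= (2 * r)%:E.
  move=> yd; rewrite EFinM -rE (le_trans _ (comp n y yd))//.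
  by under eq_integral do rewrite min_l ?leey//.
move=> /(_ comp') h.
have {h} := le_trans h (leeD capn (lexx _)).
move: tail; set p := P n x _.
have pfin : p \is a fin_num by exact: fin_num_measure (measurable_exit_gt _ _ _).
rewrite -(fineK pfin) -!EFinM -EFinD !lee_fin; set q := fine p => tail h.
have qle : (q <= b / t)%R by rewrite ler_pdivlMr// mulrC.
have bt : (2 * (b / t) = (eta / 2) / (b + eta / 2))%R.
  rewrite /t; field; apply/andP; split; rewrite gt_eqF//; lra.
have h2 : (2 * r * q <= r * ((eta / 2) / (b + eta / 2)))%R.
  by have := ler_wpM2l r0' qle; rewrite -bt; set u := (b / t)%R; lra.
have h3 : (r * (b + eta / 2) <= b * (b + eta / 2) + r * (eta / 2))%R.
  have c0 : (0 < b + eta / 2)%R by lra.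
  have : (r * (b + eta / 2) <= (b + r * ((eta / 2) / (b + eta / 2))) * (b + eta / 2))%R.
    by rewrite ler_pM2r//; lra.
  by rewrite mulrDl -mulrA divfK ?gt_eqF.
(* The absorption leaves r * b / (b + eta/2) <= b, that is, r <= b + eta/2 = a + eta. *)
have : (r * b <= (b + eta / 2) * b)%R by lra.
by rewrite ler_pM2r// /b; lra.
Qed.

End exit_limits.

(** * Green kernels and tents *)

Section green.
Variables (R : realType) (J : nd_interval R).
Local Notation state := (state J).
Local Notation Omega := (path_space J).
Local Notation Jo := (@inner R J).
Implicit Types (w : Omega) (z d t : R) (P : state -> probability Omega R).
Implicit Types (x y : state) (m : {measure set state -> \bar R}).

Definition inJo (r : R) := (nd_set J)° r.

Lemma exists_state r : nd_set J r -> exists y : state, val y = r.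
Proof. by move=> Jr; exists (exist _ r (mem_set Jr)). Qed.

Lemma inJo_state r : inJo r -> exists2 y : state, val y = r & Jo y.
Proof.
move=> Ir; have Jr := @interior_subset _ (nd_set J) _ Ir.
by exists (exist _ r (mem_set Jr)).
Qed.

Lemma inJo_between (u v r : R) : nd_set J u -> nd_set J v -> u < r < v -> inJo r.
Proof.
move=> Ju Jv urv.
have : \forall s \near r, s \in `]u, v[ by exact: near_in_itvoo.
apply: filterS => s; rewrite in_itv/= => /andP[us sv].
by apply: (nd_is_interval Ju Jv); rewrite !ltW.
Qed.

Lemma state_mem x : nd_set J (val x).
Proof. exact: set_valP x. Qed.

Lemma inJo_mem r : inJo r -> nd_set J r.
Proof. exact: interior_subset. Qed.

Lemma inJo_near r : inJo r -> exists2 e : R, 0 < e & forall s, `|s - r| < e -> inJo s.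
Proof.
move=> /(@open_interior _ (nd_set J))/nbhs_ballP[e /= e0 He]; exists e => // s sr.
by apply: He; rewrite /ball/= distrC.
Qed.

(* [adm c x d]: the ball of radius [d] around [x] in the state space ends
   inside the interior of [J], and the Green kernel of the ball at [x] is [c]
   times the tent [max 0 (d - |. - x|)]. *)
Definition adm (c : R) x d := 0 < d /\
  [\/ [/\ c = 1, inJo (val x - d) & inJo (val x + d)],
      [/\ c = 2, is_left_end x & inJo (val x + d)]
    | [/\ c = 2, is_right_end x & inJo (val x - d)]].

Definition tent z d y : R := Num.max 0 (d - dist_from z y).

Lemma tent_ge0 z d y : 0 <= tent z d y.
Proof. by rewrite le_max lexx. Qed.

Lemma adm_gt0 c x d : adm c x d -> 0 < c.
Proof. by move=> [_ [] [-> _ _]]. Qed.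

Lemma adm_le c x d d' : adm c x d -> 0 < d' -> d' <= d -> adm c x d'.
Proof.
move=> [d0 H] d'0; rewrite le_eqVlt => /predU1P[->|d'd]; first by split.
have Jx := state_mem x; split=> //; case: H => -[-> h1 h2].
- apply: Or31; split=> //.
    by apply: (inJo_between (inJo_mem h1) Jx); apply/andP; split; lra.
  by apply: (inJo_between Jx (inJo_mem h2)); apply/andP; split; lra.
- apply: Or32; split=> //.
  by apply: (inJo_between Jx (inJo_mem h2)); apply/andP; split; lra.
- apply: Or33; split=> //.
  by apply: (inJo_between (inJo_mem h2) Jx); apply/andP; split; lra.
Qed.

Lemma adm_open c x d : adm c x d -> exists2 e : R, 0 < e & adm c x (d + e).
Proof.
move=> [d0 [] [-> h1 h2]].
- have [e1 e10 H1] := inJo_near h1; have [e2 e20 H2] := inJo_near h2.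
  pose e := Num.min e1 e2 / 2.
  have e0 : 0 < e by rewrite divr_gt0// lt_min e10.
  have ee1 : e < e1 by rewrite ltr_pdivrMr// gt_min; apply/orP; left; lra.
  have ee2 : e < e2 by rewrite ltr_pdivrMr// gt_min; apply/orP; right; lra.
  exists e => //; split; first lra; apply: Or31; split=> //.
    by apply: H1; rewrite [X in `|X|](_ : _ = - e) ?normrN ?gtr0_norm//; lra.
  by apply: H2; rewrite [X in `|X|](_ : _ = e) ?gtr0_norm//; lra.
- have [e e0 H] := inJo_near h2; exists (e / 2); first lra.
  split; first lra; apply: Or32; split=> //.
  by apply: H; rewrite [X in `|X|](_ : _ = e / 2) ?gtr0_norm//; lra.
- have [e e0 H] := inJo_near h2; exists (e / 2); first lra.
  split; first lra; apply: Or33; split=> //.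
  by apply: H; rewrite [X in `|X|](_ : _ = - (e / 2)) ?normrN ?gtr0_norm//; lra.
Qed.

Lemma exit_hit z d w : 0 <= d ->
  exit z d w = mine (hit (z - d) w) (hit (z + d) w).
Proof.
move=> d0; apply/le_anti/andP; split.
  rewrite le_min; apply/andP; split; apply: le_ereal_inf_tmp => _ [s /= sd <-];
    apply: hitg_lb; rewrite /dist_from.
  - by rewrite [X in X - z]sd addrC addKr normrN ger0_norm.
  - by rewrite [X in X - z]sd addrC addKr ger0_norm.
apply: le_ereal_inf_tmp => _ [s sd <-]; rewrite ge_min.
have {sd} : `|val (w s) - z| = d := sd.
have [sz|zs] := leP (val (w s)) z => sd; apply/orP; [left|right];
  apply: ereal_inf_lbound; exists s => //.
  suff : val (w s) = z - d by [].
  by move: sd; rewrite ler0_norm ?subr_le0// => <-; rewrite opprK addrC subrK.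
suff : val (w s) = z + d by [].
by move: sd; rewrite ger0_norm ?subr_ge0 ?(ltW zs)// => <-; rewrite addrC subrK.
Qed.

(** For a ball around an endpoint one of the two boundary values lies outside [J]; its hitting time
    then drops out of the minimum in [exit_hit]. *)
Lemma hit_outside (r : R) w : ~ nd_set J r -> hit r w = +oo%E.
Proof.
move=> Jr; rewrite /hit (_ : [set _ | _ in _] = set0) ?ereal_inf0//.
apply/seteqP; split=> // _ [s /= sr _]; apply: Jr; rewrite -sr.
exact: state_mem.
Qed.

(** Starting from the midpoint, one of the two factors of the kernel is [d] and cancels against half
    the width. *)
Lemma green_tent z d y : 0 < d ->
  green (z - d) (z + d) z (val y) = tent z d y.
Proof.
move=> d0; rewrite /green /tent /dist_from; move: (val y) => v.
have -> : z - d <= z <= z + d by apply/andP; split; lra.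
rewrite /=; case: ifPn => [/andP[h1 h2]|].
  have [vz|zv] := leP v z.
    rewrite ler0_norm ?subr_le0// max_r; last lra.
    by field; rewrite gt_eqF; lra.
  rewrite ger0_norm ?subr_ge0 ?(ltW zv)// max_r; last lra.
  by field; rewrite gt_eqF; lra.
rewrite negb_and -!ltNge => h; apply/esym/max_idPl; rewrite subr_le0.
case/orP: h => h; [rewrite ler0_norm|rewrite ger0_norm]; lra.
Qed.

(** The kernel is p * q / d with both factors at most 2 * d, and the factor on the side of [y] is at
    most the tent at [y]. This is the origin of the 2 in the comparison of expected exit times. *)
Lemma green_le_tent z d (u : R) y : 0 < d ->
  green (z - d) (z + d) u (val y) <= 2 * tent z d y.
Proof.
move=> d0; rewrite /green; case: ifPn => [|_]; last by rewrite mulr_ge0// tent_ge0.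
rewrite /tent /dist_from; move: (val y) => v /andP[/andP[u1 u2] /andP[v1 v2]].
have p0 : 0 <= Num.min u v - (z - d) by rewrite subr_ge0 le_min u1 v1.
have q0 : 0 <= z + d - Num.max u v by rewrite subr_ge0 ge_max u2 v2.
have pv : Num.min u v - (z - d) <= v - (z - d) by rewrite lerD2r ge_min lexx orbT.
have qv : z + d - Num.max u v <= z + d - v by rewrite lerD2l lerN2 le_max lexx orbT.
rewrite ler_pdivrMr; last lra.
move: (Num.min u v - (z - d)) (z + d - Num.max u v) p0 q0 pv qv => p q p0 q0 pv qv.
have [vz|zv] := leP v z.
  rewrite ler0_norm ?subr_le0// max_r; last lra.
  have : p * q <= (v - (z - d)) * (2 * d) by apply: ler_pM => //; lra.
  lra.
rewrite ger0_norm ?subr_ge0 ?(ltW zv)// max_r; last lra.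
have : p * q <= (2 * d) * (z + d - v) by apply: ler_pM => //; lra.
lra.
Qed.

Lemma green_ge0 (a b u v : R) : a < b -> 0 <= green a b u v.
Proof.
move=> ab; rewrite /green; case: ifPn => // /andP[/andP[u1 u2] /andP[v1 v2]].
rewrite divr_ge0 ?subr_ge0 ?(ltW ab)// !mulr_ge0// subr_ge0.
  by rewrite le_min u1 v1.
by rewrite ge_max u2 v2.
Qed.

Lemma green_left_tent (l : state) d y : is_left_end l -> 0 < d ->
  green_left (val l) (val l + d) (val l) (val y) = 2 * tent (val l) d y.
Proof.
move=> ll d0; have := ll y; rewrite /green_left /tent /dist_from.
move: (val y) (val l) => v z zv.
have -> : z <= z <= z + d by apply/andP; split; lra.
rewrite ger0_norm ?subr_ge0// zv/= max_r//; case: ifPn => [h|].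
  by rewrite max_r; lra.
by rewrite -ltNge => h; rewrite max_l ?mulr0//; lra.
Qed.

Lemma green_right_tent (r : state) d y : is_right_end r -> 0 < d ->
  green_right (val r - d) (val r) (val r) (val y) = 2 * tent (val r) d y.
Proof.
move=> rr d0; have := rr y; rewrite /green_right /tent /dist_from.
move: (val y) (val r) => v z vz.
have -> : z - d <= z <= z by apply/andP; split; lra.
rewrite ler0_norm ?subr_le0// vz/= andbT min_r//; case: ifPn => [h|].
  by rewrite max_r; lra.
by rewrite -ltNge => h; rewrite max_l ?mulr0//; lra.
Qed.

Lemma green_left_le (l b u v : R) : 0 <= green_left l b u v <= green_left l b l v.
Proof.
rewrite /green_left; case: ifPn => [/andP[/andP[u1 u2] /andP[v1 v2]]|_].
  rewrite lexx (le_trans u1 u2) v1 v2/= (max_r v1).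
  apply/andP; split; first by rewrite mulr_ge0// subr_ge0 ge_max u2.
  by rewrite ler_wpM2l// lerD2l lerN2 le_max lexx orbT.
case: ifPn => [/andP[/andP[u1 u2] /andP[v1 v2]]|_]; last by rewrite lexx.
by rewrite lexx mulr_ge0// subr_ge0 ge_max u2.
Qed.

Lemma green_right_le (a r u v : R) : 0 <= green_right a r u v <= green_right a r r v.
Proof.
rewrite /green_right; case: ifPn => [/andP[/andP[u1 u2] /andP[v1 v2]]|_].
  rewrite lexx (le_trans u1 u2) v1 v2/= (min_r v2).
  apply/andP; split; first by rewrite mulr_ge0// subr_ge0 le_min u1.
  by rewrite ler_wpM2l// lerD2r ge_min lexx orbT.
case: ifPn => [/andP[/andP[u1 u2] /andP[v1 v2]]|_]; last by rewrite lexx.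
by rewrite lexx mulr_ge0// subr_ge0 le_min u1.
Qed.

Lemma continuous_tent z d : continuous (tent z d).
Proof.
move=> x; apply: (@continuous_max R state (cst 0) (fun y => d - dist_from z y)).
  exact: cst_continuous.
apply: (@continuousB R R^o state (cst d) (dist_from z)); first exact: cst_continuous.
exact: continuous_dist_from.
Qed.

Lemma measurable_tent z d : measurable_fun setT (tent z d).
Proof. by apply: continuous_measurable_state; exact: continuous_tent. Qed.

(** A nonnegative integral is a supremum over the simple functions below the integrand, which makes
    monotonicity immediate. This spares measurability proofs for the Green kernels. *)
Lemma ge0_le_integral_nomeas (disp : measure_display) (T : measurableType disp)
    (mu : {measure set T -> \bar R}) (D : set T) (f g : T -> \bar R) :
  (forall u, D u -> 0 <= f u)%E -> (forall u, D u -> f u <= g u)%E ->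
  (\int[mu]_(u in D) f u <= \int[mu]_(u in D) g u)%E.
Proof.
move=> f0 fg.
have g0 u : D u -> (0 <= g u)%E by move=> Du; exact: le_trans (f0 u Du) (fg u Du).
rewrite !ge0_integralE//; apply: le_ereal_sup => _ [h hf <-]; exists h => // u.
apply: (le_trans (hf u)); rewrite /patch; case: ifPn => //; rewrite inE; exact: fg.
Qed.

Lemma tent_inner z d y : inJo (z - d) -> inJo (z + d) -> ~ Jo y -> tent z d y = 0.
Proof.
move=> h1 h2 Jy; apply: max_l; rewrite subr_le0 leNgt; apply/negP => yd; apply: Jy.
apply: (inJo_between (inJo_mem h1) (inJo_mem h2)).
by move: yd; rewrite /dist_from ltr_distl.
Qed.

Lemma integral_inner m (f : state -> \bar R) : (forall y, ~ Jo y -> f y = 0%E) ->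
  (\int[m]_(y in Jo) f y = \int[m]_y f y)%E.
Proof.
move=> f0; rewrite integral_mkcond; congr integral; apply/funext => y.
by rewrite /patch; case: ifPn => //; rewrite notin_setE => /f0.
Qed.

Lemma exit_green_tent c x d P m : adm c x d -> speed_measure_of P m ->
  (\int[P x]_w exit (val x) d w = c%:E * \int[m]_y (tent (val x) d y)%:E)%E.
Proof.
move=> [d0 H] [_ mi ml mr].
have mt : measurable_fun setT (fun y => (tent (val x) d y)%:E).
  by apply/measurable_EFinP; exact: measurable_tent.
have mulE (k : R) : 0 <= k ->
    (k%:E * \int[m]_y (tent (val x) d y)%:E = \int[m]_y (k * tent (val x) d y)%:E)%E.
  move=> k0; under [RHS]eq_integral do rewrite EFinM.
  by rewrite ge0_integralZl_EFin// => y _; rewrite lee_fin tent_ge0.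
under eq_integral do rewrite (exit_hit _ _ (ltW d0)).
case: H => -[-> h1 h2].
- have [a aE Ja] := inJo_state h1; have [b bE Jb] := inJo_state h2.
  rewrite -aE -bE mi//; last 2 first.
  + by rewrite aE bE; lra.
  + by rewrite aE bE; apply/andP; split; lra.
  rewrite mul1e; under eq_integral do rewrite aE bE green_tent//.
  by apply: integral_inner => y Jy; rewrite (tent_inner h1 h2).
- have [b bE Jb] := inJo_state h2.
  have out : ~ nd_set J (val x - d).
    by move=> /exists_state[u uE]; have := h1 u; rewrite uE leNgt gtrBl d0.
  under eq_integral do rewrite (hit_outside _ out) min_r ?leey//.
  rewrite -bE (ml x h1).1//; last by rewrite bE lexx lerDl ltW.
  by rewrite mulE//; apply: eq_integral => y _; rewrite bE green_left_tent.
- have [b bE Jb] := inJo_state h2.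
  have out : ~ nd_set J (val x + d).
    by move=> /exists_state[u uE]; have := h1 u; rewrite uE gerDl leNgt d0.
  under eq_integral do rewrite (hit_outside _ out) min_l ?leey//.
  rewrite -bE (mr x h1).1//; last by rewrite bE lexx gerBl ltW.
  by rewrite mulE//; apply: eq_integral => y _; rewrite bE green_right_tent.
Qed.

(** In the interior this is [green_le_tent] integrated. At an endpoint the kernel is largest when
    started from the endpoint, so the factor 2 is generous there. *)
Lemma exit_comparison c x d P m y : adm c x d -> speed_measure_of P m ->
  dist_from (val x) y < d ->
  (\int[P y]_w exit (val x) d w <= 2%:E * \int[P x]_w exit (val x) d w)%E.
Proof.
move=> axd sP yd; rewrite (exit_green_tent axd sP); case: axd sP => d0 H [_ mi ml mr].
have mt (k : R) : measurable_fun setT (fun u => (k * tent (val x) d u)%:E).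
  apply/measurable_EFinP; apply: measurable_funM => //; exact: measurable_tent.
have mulE (k : R) : 0 <= k ->
    (k%:E * \int[m]_u (tent (val x) d u)%:E = \int[m]_u (k * tent (val x) d u)%:E)%E.
  move=> k0; under [RHS]eq_integral do rewrite EFinM.
  rewrite ge0_integralZl_EFin//; first by move=> u _; rewrite lee_fin tent_ge0.
  by have := mt 1; under eq_fun do rewrite mul1r.
have c0 : 0 <= c by case: H => -[->].
have -> : (2%:E * (c%:E * \int[m]_u (tent (val x) d u)%:E) =
    \int[m]_u (2%:E * (c * tent (val x) d u)%:E))%E.
  rewrite mulE// ge0_integralZl_EFin//.
  by move=> u _; rewrite lee_fin mulr_ge0// tent_ge0.
move: yd; rewrite /dist_from ltr_distl => /andP[yl yr].
under eq_integral do rewrite (exit_hit _ _ (ltW d0)).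
case: H => -[-> h1 h2].
- have [a aE Ja] := inJo_state h1; have [b bE Jb] := inJo_state h2.
  rewrite -aE -bE mi//; last 2 first.
  + by rewrite aE bE; lra.
  + by rewrite aE bE (ltW yl) (ltW yr).
  rewrite -(integral_inner m (f := fun u => (2%:E * (1 * tent (val x) d u)%:E)%E)); last first.
    by move=> u Ju; rewrite (tent_inner h1 h2)// mulr0 mule0.
  apply: ge0_le_integral_nomeas => u Ju; first by rewrite lee_fin green_ge0// aE bE; lra.
  by rewrite -EFinM lee_fin aE bE mul1r green_le_tent.
- have [b bE Jb] := inJo_state h2.
  have out : ~ nd_set J (val x - d).
    by move=> /exists_state[u uE]; have := h1 u; rewrite uE leNgt gtrBl d0.
  under eq_integral do rewrite (hit_outside _ out) min_r ?leey//.
  rewrite -bE (ml x h1).1//; last by rewrite bE h1 ltW.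
  apply: ge0_le_integral_nomeas => u _.
    by rewrite lee_fin; case/andP: (green_left_le (val x) (val b) (val y) (val u)).
  rewrite -EFinM lee_fin bE -green_left_tent//.
  have /andP[g0 gle] := green_left_le (val x) (val x + d) (val y) (val u).
  by apply: (le_trans gle); rewrite ler_peMl ?ler1n// (le_trans g0).
- have [b bE Jb] := inJo_state h2.
  have out : ~ nd_set J (val x + d).
    by move=> /exists_state[u uE]; have := h1 u; rewrite uE gerDl leNgt d0.
  under eq_integral do rewrite (hit_outside _ out) min_l ?leey//.
  rewrite -bE (mr x h1).1//; last by rewrite bE h1 ltW.
  apply: ge0_le_integral_nomeas => u _.
    by rewrite lee_fin; case/andP: (green_right_le (val b) (val x) (val y) (val u)).
  rewrite -EFinM lee_fin bE -green_right_tent//.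
  have /andP[g0 gle] := green_right_le (val x - d) (val x) (val y) (val u).
  by apply: (le_trans gle); rewrite ler_peMl ?ler1n// (le_trans g0).
Qed.

Lemma compact_inner_finite m (K : set state) : locally_finite_inner m ->
  measurable K -> compact K -> K `<=` Jo -> (m K < +oo)%E.
Proof.
move=> lf mK; rewrite compact_cover => cK KJ.
pose U (x : state) := if pselect (Jo x) is left Jx then projT1 (cid (lf x Jx)) else set0.
have UP x : Jo x -> [/\ open (U x), U x x & m (U x) < +oo]%E.
  by rewrite /U; case: pselect => // Jx _; case: cid.
have oU x : K x -> open (U x) by move=> /KJ/UP[].
have KU : K `<=` \bigcup_(x in K) U x by move=> x Kx; exists x => //; have [] := UP x (KJ x Kx).
have [D DK KD] := cK _ K U oU KU.
have fin (s : seq state) : {subset s <= K} ->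
    measurable (\big[setU/set0]_(x <- s) U x) /\ (m (\big[setU/set0]_(x <- s) U x) < +oo)%E.
  elim: s => [_|x s IH sK]; first by rewrite big_nil measure0; split.
  have [oUx _ mUx] : [/\ open (U x), U x x & m (U x) < +oo]%E.
    by apply: UP; apply: KJ; rewrite -inE; apply: sK; rewrite mem_head.
  have [ms fs] : measurable (\big[setU/set0]_(x <- s) U x) /\
      (m (\big[setU/set0]_(x <- s) U x) < +oo)%E.
    by apply: IH => y ys; apply: sK; rewrite in_cons ys orbT.
  have mU := open_measurable_state oUx.
  rewrite big_cons; split; first exact: measurableU.
  by apply: (le_lt_trans (measureU2 m mU ms)); exact: lte_add_pinfty.
have [mD finD] := fin (finmap.enum_fset D) DK.
apply: le_lt_trans finD; apply: le_measure; rewrite ?inE//.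
by move=> x /KD; rewrite /cover bigcup_fset.
Qed.

Definition seg (a b : R) : set state := [set y | a <= val y <= b].

Lemma seg_compact (a b : R) : inJo a -> inJo b -> compact (seg a b).
Proof.
move=> Ia Ib; have [ab|ba] := leP a b; last first.
  rewrite (_ : seg a b = set0); first exact: compact0.
  by apply/seteqP; split=> // y /andP[/le_trans h /h]; rewrite leNgt ba.
(* Clamping to [a, b] defines a continuous map from all reals to states, of which [seg a b] is the
   image of a compact interval. *)
have Jr (r : R) : nd_set J (Num.max a (Num.min b r)).
  apply: (nd_is_interval (inJo_mem Ia) (inJo_mem Ib)).
  by rewrite le_max lexx/= ge_max ab ge_min lexx.
pose p (r : R) : state := projT1 (cid (exists_state (Jr r))).
have pE r : val (p r) = Num.max a (Num.min b r) by rewrite /p; case: cid.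
have cp : continuous p.
  apply/continuous_comp_initial.
  rewrite (_ : _ \o _ = fun r => Num.max a (Num.min b r)); last exact/funext.
  move=> r.
  apply: (@continuous_max R R (cst a) (fun r => Num.min b r)); first exact: cst_continuous.
  by apply: (@continuous_min R R (cst b) id); [exact: cst_continuous|exact: cvg_id].
rewrite (_ : seg a b = p @` `[a, b]).
  by apply: continuous_compact; [exact: continuous_subspaceT|exact: segment_compact].
apply/seteqP; split=> [y /= /andP[ay yb]|_ [r /= + <-]].
  exists (val y); first by rewrite /= in_itv/= ay.
  by apply: val_inj; rewrite pE (min_idPr yb) (max_idPr ay).
by rewrite in_itv/= => /andP[ar rb]; rewrite /seg/= pE (min_idPr rb) (max_idPr ar) ar.
Qed.

Lemma seg_inner (a b : R) : inJo a -> inJo b -> seg a b `<=` Jo.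
Proof.
move=> Ia Ib y /andP[]; rewrite le_eqVlt => /predU1P[ay _|ay].
  by rewrite /inner /= -ay.
rewrite le_eqVlt => /predU1P[yE|yb]; first by rewrite /inner/= yE.
by apply: (inJo_between (inJo_mem Ia) (inJo_mem Ib)); rewrite ay.
Qed.

Lemma measurable_seg (a b : R) : measurable (seg a b).
Proof.
have -> : seg a b = setT `&` val @^-1` `[a, b].
  by rewrite setTI; apply/seteqP; split=> y; rewrite /seg/= in_itv.
by apply: continuous_measurable_state => //; exact: continuous_state_val.
Qed.

Lemma seg_finite m (a b : R) : locally_finite_inner m -> inJo a -> inJo b ->
  (m (seg a b) < +oo)%E.
Proof.
by move=> lf Ia Ib; apply: compact_inner_finite => //;
  [exact: measurable_seg|exact: seg_compact|exact: seg_inner].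
Qed.

(** Away from its center the ball lies in a compact segment of the interior, where the speed
    measures are finite. Infinite mass can only sit near the center, when that is an endpoint. *)
Lemma adm_annulus c x d (e : R) : adm c x d -> 0 < e -> e < d ->
  exists a b : R, [/\ inJo a, inJo b, a < b &
    forall y, e <= dist_from (val x) y -> dist_from (val x) y <= d -> a <= val y <= b].
Proof.
move=> [d0 H] e0 ed; have Jx := state_mem x; case: H => -[_ h1 h2].
- exists (val x - d), (val x + d); split=> //; first lra.
  by move=> y _; rewrite /dist_from ler_distl.
- exists (val x + e), (val x + d); split=> //; [|lra|].
    by apply: (inJo_between Jx (inJo_mem h2)); apply/andP; split; lra.
  by move=> y; rewrite /dist_from ger0_norm ?subr_ge0 ?h1// => *; apply/andP; split; lra.
- exists (val x - d), (val x - e); split=> //; [|lra|].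
    by apply: (inJo_between (inJo_mem h2) Jx); apply/andP; split; lra.
  by move=> y; rewrite /dist_from ler0_norm ?subr_le0 ?h1// => *; apply/andP; split; lra.
Qed.

End green.

(** * Convergence of the integrals of tents *)

Section tent_convergence.
Variables (R : realType) (J : nd_interval R).
Local Notation state := (state J).
Local Notation Omega := (path_space J).
Local Notation Jo := (@inner R J).
Implicit Types (x y : state) (m : {measure set state -> \bar R}).

(** Splits convergence in [0, +oo] into two one-sided bounds, the upper one being required only for
    a finite limit. *)
Lemma cvge_criterion (u : nat -> \bar R) (l : \bar R) : (0 <= l)%E ->
  (forall M : R, (M%:E < l)%E -> \forall n \near \oo, (M%:E < u n)%E) ->
  ((l < +oo)%E -> forall eta : R, 0 < eta ->
    \forall n \near \oo, (u n <= l + eta%:E)%E) ->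
  u n @[n --> \oo] --> l.
Proof.
case: l => [r| |//] r0 lo up; last first.
  by apply/cvgeyPgt => A; exact/lo/ltry.
have near_fin : \forall n \near \oo, u n \is a fin_num.
  have h1 : \forall n \near \oo, ((r - 1)%:E < u n)%E by apply: lo; rewrite lte_fin; lra.
  apply: filterS2 h1 (up (ltry _) 1 ltr01) => n h3 h4; rewrite fin_numE; apply/andP; split.
    by apply: contraTN h3 => /eqP ->.
  by apply: contraTN h4 => /eqP ->.
apply/fine_cvgP; split=> //; apply/cvgrPdist_le => e e0.
have h1 : \forall n \near \oo, ((r - e)%:E < u n)%E by apply: lo; rewrite lte_fin; lra.
apply: filterS3 near_fin h1 (up (ltry _) e e0) => n un.
rewrite /= -(fineK un) -EFinD lte_fin lee_fin => h3 h4.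
by rewrite ler_distlC; apply/andP; split; lra.
Qed.

Lemma measurable_dist_le (z D : R) : measurable [set y : state | dist_from z y <= D].
Proof.
have -> : [set y : state | dist_from z y <= D] = setT `&` dist_from z @^-1` `]-oo, D].
  by rewrite setTI; apply/seteqP; split=> y /=; rewrite in_itv.
by apply: continuous_measurable_state => //; exact: continuous_dist_from.
Qed.

Lemma tent_integral_ge0 m z d : (0 <= \int[m]_y (tent z d y)%:E)%E.
Proof. by apply: integral_ge0 => y _; rewrite lee_fin tent_ge0. Qed.

Lemma measurable_EFin_tent z d :
  measurable_fun setT (fun y : state => (tent z d y)%:E).
Proof. by apply/measurable_EFinP; exact: measurable_tent. Qed.

(** The tent is at least [d / 2] on the ball of radius [d / 2], so its integral controls the mass
    near the center; the rest of the larger ball lies in a compact segment of the interior. *)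
Lemma adm_ball_finite c x d D m : locally_finite_inner m -> 0 < d ->
  adm c x D -> (\int[m]_y (tent (val x) d y)%:E < +oo)%E ->
  (m [set y : state | (dist_from (val x) y <= D)%R] < +oo)%E.
Proof.
move=> lf d0 axD fin; have D0 : 0 < D by case: axD.
pose e := Num.min (d / 2) (D / 2).
have ed : e <= d / 2 by rewrite ge_min lexx.
have eD : e <= D / 2 by rewrite ge_min lexx orbT.
have e0 : 0 < e by rewrite lt_min !divr_gt0.
have [|a [b [Ia Ib ab H]]] := adm_annulus axD e0; first lra.
set B := [set y : state | dist_from (val x) y <= e].
have mB : measurable B by exact: measurable_dist_le.
have mBfin : (m B < +oo)%E.
  have : ((d / 2)%:E * m B <= \int[m]_y (tent (val x) d y)%:E)%E.
    rewrite -integral_cst//.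
    apply: (@le_trans _ _ (\int[m]_(y in B) (tent (val x) d y)%:E)%E).
      apply: ge0_le_integral => //.
      - by move=> y _; rewrite lee_fin divr_ge0// ltW.
      - by apply: measurable_funTS; exact: measurable_EFin_tent.
      - by move=> y; rewrite /B/= lee_fin /tent le_max => yB; apply/orP; right; lra.
    apply: ge0_subset_integral => //; first exact: measurable_EFin_tent.
    by move=> y _; rewrite lee_fin tent_ge0.
  move=> /le_lt_trans /(_ fin); apply: contraTT; rewrite -!leNgt !leye_eq => /eqP ->.
  by rewrite gt0_muley// lte_fin divr_gt0.
apply: (@le_lt_trans _ _ (m (B `|` seg a b))).
  apply: le_measure; rewrite ?inE; first exact: measurable_dist_le.
    by apply: measurableU => //; exact: measurable_seg.
  move=> y /= yD; have [yB|By] := leP (dist_from (val x) y) e; first by left.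
  by right; apply: H => //; exact: ltW.
apply: (le_lt_trans (measureU2 m mB (@measurable_seg _ _ a b))).
by apply: lte_add_pinfty => //; exact: seg_finite.
Qed.

Lemma tent_finite_inner x d m : locally_finite_inner m -> 0 < d ->
  inJo J (val x - d) -> inJo J (val x + d) ->
  (\int[m]_y (tent (val x) d y)%:E < +oo)%E.
Proof.
move=> lf d0 h1 h2.
apply: (@le_lt_trans _ _ (\int[m]_(y in seg (val x - d) (val x + d)) cst d%:E y)%E).
  rewrite [leRHS]integral_mkcond; apply: ge0_le_integral_nomeas => y _.
    by rewrite lee_fin tent_ge0.
  rewrite /patch; case: ifPn => [_|].
    by rewrite lee_fin /tent ge_max (ltW d0) gerBl /dist_from normr_ge0.
  rewrite notin_setE => yn; rewrite lee_fin ge_max lexx /= subr_le0 leNgt.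
  apply/negP; rewrite /dist_from ltr_distl => /andP[/ltW p /ltW q].
  by apply: yn; rewrite /seg/= p q.
rewrite integral_cst; last exact: measurable_seg.
by apply: lte_mul_pinfty => //; [rewrite lee_fin ltW|exact: seg_finite].
Qed.

(** Left continuity in the radius, by monotone convergence; the form with [M] covers infinite
    integrals too. *)
Lemma tent_shrink z d m (M : R) : 0 < d ->
  (M%:E < \int[m]_y (tent z d y)%:E)%E ->
  exists e : R, [/\ 0 < e, e < d & (M%:E < \int[m]_y (tent z (d - e) y)%:E)%E].
Proof.
move=> d0 Mlt.
pose e (k : nat) := d / 2 * @harmonic R k.
have e0 k : 0 < e k by rewrite mulr_gt0// ?divr_gt0// invr_gt0.
have ed k : e k < d.
  have : @harmonic R k <= 1 by rewrite invf_le1// ler1n.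
  move=> /(ler_wpM2l (ltW (divr_gt0 d0 (ltr0n R 2)))); rewrite -/(e k); lra.
apply/not_existsP => H; move: Mlt; rewrite ltNge => /negP; apply.
have -> : (\int[m]_y (tent z d y)%:E =
    \int[m]_y limn (fun k => (tent z (d - e k) y)%:E))%E.
  apply: eq_integral => y _; apply/esym/cvg_lim => //.
  apply: cvg_EFin; first exact: nearW.
  have h : e k @[k --> \oo] --> 0.
    rewrite -[X in _ --> X](mulr0 (d / 2)).
    by apply: cvgM; [exact: cvg_cst|exact: cvg_harmonic].
  have ch : continuous (fun r : R => Num.max 0 (d - r - dist_from z y)).
    move=> r; apply: (@continuous_max R R (cst 0) (fun r => d - r - dist_from z y)).
      exact: cst_continuous.
    apply: (@continuousB R R^o R (fun r => d - r) (cst _)); last exact: cst_continuous.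
    by apply: (@continuousB R R^o R (cst d) id); [exact: cst_continuous|exact: cvg_id].
  have -> : tent z d y = Num.max 0 (d - 0 - dist_from z y) by rewrite subr0.
  exact: (cvg_comp _ _ h (ch 0)).
have nd y a b : (a <= b)%N -> ((tent z (d - e a) y)%:E <= (tent z (d - e b) y)%:E)%E.
  move=> ab; rewrite lee_fin /tent ge_max !le_max lexx/= lerD2r lerD2l lerN2.
  apply/orP; right; rewrite ler_wpM2l ?divr_ge0 ?(ltW d0)//.
  by rewrite lef_pV2 ?posrE// ler_nat.
rewrite monotone_convergence//; last 3 first.
- by move=> k; exact: measurable_EFin_tent.
- by move=> k y _; rewrite lee_fin tent_ge0.
- by move=> y _ a b; exact: nd.
apply: lime_le.
  apply: ereal_nondecreasing_is_cvgn => a b ab; apply: ge0_le_integral_nomeas => y _.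
    by rewrite lee_fin tent_ge0.
  exact: nd.
by apply: nearW => k; rewrite leNgt; apply/negP => Mk; apply: (H (e k)).
Qed.

(** Enlarging the radius by [e] raises the tent by at most [e], and only on a ball of finite
    mass. *)
Lemma tent_expand c x d m (eta : R) : locally_finite_inner m -> adm c x d ->
  (\int[m]_y (tent (val x) d y)%:E < +oo)%E -> 0 < eta ->
  exists e : R, [/\ 0 < e, adm c x (d + e) &
    (\int[m]_y (tent (val x) (d + e) y)%:E <=
     \int[m]_y (tent (val x) d y)%:E + eta%:E)%E].
Proof.
move=> lf axd fin eta0; have d0 : 0 < d by case: axd.
have [e1 e10 axe1] := adm_open axd.
set B := [set y : state | dist_from (val x) y <= d + e1].
have Bfin : (m B < +oo)%E by exact: adm_ball_finite lf d0 axe1 fin.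
have mB : measurable B by exact: measurable_dist_le.
have Bfn : m B \is a fin_num by rewrite ge0_fin_numE// measure_ge0.
have b0 : 0 <= fine (m B) by rewrite fine_ge0// measure_ge0.
pose e := Num.min e1 (eta / (fine (m B) + 1)).
have e0 : 0 < e by rewrite lt_min e10 divr_gt0//; lra.
exists e; split=> //.
  by apply: (adm_le axe1); [rewrite addr_gt0|rewrite lerD2l ge_min lexx].
apply: (@le_trans _ _ (\int[m]_y ((tent (val x) d y)%:E + (e * \1_B y)%:E))%E).
  apply: ge0_le_integral_nomeas => y _; first by rewrite lee_fin tent_ge0.
  rewrite -EFinD lee_fin indicE; have [yB|yB] := boolP (y \in B).
    rewrite mulr1 /tent ge_max addr_ge0 ?(ltW e0) ?le_max ?lexx//=.
    rewrite addrAC lerD2r le_max lexx orbT//.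
  rewrite mulr0 addr0 /tent ge_max le_max lexx/=.
  move: yB; rewrite notin_setE /B /= => /negP; rewrite -ltNge => yB.
  rewrite le_max; apply/orP; left.
  have : e <= e1 by rewrite ge_min lexx.
  lra.
rewrite ge0_integralD//; last 4 first.
- by move=> y _; rewrite lee_fin tent_ge0.
- exact: measurable_EFin_tent.
- by move=> y _; rewrite lee_fin mulr_ge0// ltW.
- by apply/measurable_EFinP; apply: measurable_funM => //; exact: measurable_indic.
rewrite leeD2l//; under eq_integral do rewrite EFinM.
rewrite ge0_integralZl_EFin ?(ltW e0)//; last first.
  by apply/measurable_EFinP; exact: measurable_indic.
rewrite integral_indic// setIT -(fineK Bfn) -EFinM lee_fin.
apply: (@le_trans _ _ (eta / (fine (m B) + 1) * fine (m B))).
  by rewrite ler_wpM2r// ge_min lexx orbT.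
by rewrite mulrAC ler_pdivrMr ?ltr_wpDl//; rewrite ler_wpM2l ?(ltW eta0)//; lra.
Qed.

Variables (P : nat -> state -> probability Omega R)
  (m : nat -> {measure set state -> \bar R}).
Hypothesis dP : forall n, diffusion (P n).
Hypothesis sP : forall n, speed_measure_of (P n) (m n).
Hypothesis cP : forall x, weak_cvg (P ^~ x) (P 0%N x).

Lemma tent_integral_cvg c x d : adm c x d ->
  (\int[m n]_y (tent (val x) d y)%:E)%E @[n --> \oo] -->
  (\int[m 0%N]_y (tent (val x) d y)%:E)%E.
Proof.
move=> axd; have d0 : 0 < d by case: axd.
have c0 := adm_gt0 axd.
have lf n : locally_finite_inner (m n) by case: (sP n).
have starts n : starts_at (P n x) x by case: (dP n) => _ + _; apply.
have exitE n e : adm c x e ->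
    (\int[P n x]_w exit (val x) e w = c%:E * \int[m n]_y (tent (val x) e y)%:E)%E.
  by move=> axe; exact: exit_green_tent axe (sP n).
apply: cvge_criterion; first exact: tent_integral_ge0.
  move=> M Mlt; have [e [e0 ed Me]] := tent_shrink d0 Mlt.
  have axe : adm c x (d - e) by apply: (adm_le axd); lra.
  have h : dist_from (val x) x <= d - e by rewrite dist_from_start subr_ge0 ltW.
  have cM : ((c * M)%:E < \int[P 0%N x]_w exit (val x) (d - e) w)%E.
    by rewrite exitE// EFinM lte_pmul2l// lte_fin.
  apply: filterS (exit_integral_liminf (@cP x) starts (starts 0%N) e0 h cM) => n.
  by rewrite exitE// EFinM lte_pmul2l// lte_fin.
move=> fin eta eta0; have eta2 : 0 < eta / 2 by lra.
have [e [e0 axe He]] := tent_expand (lf 0%N) axd fin eta2.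
have fine_e : (\int[P 0%N x]_w exit (val x) (d + e) w < +oo)%E.
  rewrite exitE//; apply: lte_mul_pinfty => //; first by rewrite lee_fin ltW.
  by apply: (le_lt_trans He); apply: lte_add_pinfty => //; exact: ltry.
have fin_near : \forall n \near \oo, (\int[P n x]_w exit (val x) d w < +oo)%E.
  (* Only at an endpoint does finiteness have to be transported along the sequence; otherwise the
     tent lives on a compact part of the interior and every expectation is finite. *)
  have [ex|nex] := pselect (endpoint x).
    exact: endpoint_exit_finite_near (@cP x) ex d0 e0 fine_e.
  apply: nearW => n; rewrite exitE//; apply: lte_mul_pinfty => //.
    by rewrite lee_fin ltW.
  case: axd => _ [] [_ h1 h2]; first exact: tent_finite_inner.
  - by case: nex; left.
  - by case: nex; right.
have comp n y : dist_from (val x) y < d ->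
    (\int[P n y]_w exit (val x) d w <= 2%:E * \int[P n x]_w exit (val x) d w)%E.
  by move=> yd; exact: exit_comparison axd (sP n) yd.
(* Half of [eta] pays for the larger radius and half for the limit; the factor [c] translates
   between exit times and tents. *)
have ceta : 0 < c * (eta / 2) by rewrite mulr_gt0.
have := exit_integral_limsup dP (@cP x) d0 e0 ceta comp fin_near fine_e.
apply: filterS => n; rewrite !exitE//.
rewrite EFinM -muleDr; last 2 first.
- by [].
- by rewrite ge0_adde_def// inE ?tent_integral_ge0// lee_fin ltW.
rewrite lee_pmul2l// => h; apply: (le_trans h).
apply: (@le_trans _ _ (\int[m 0%N]_y (tent (val x) d y)%:E + (eta / 2)%:E + (eta / 2)%:E)%E).
  exact: leeD2r.
by rewrite -addeA -EFinD; apply: leeD2l; rewrite lee_fin; lra.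
Qed.

End tent_convergence.

(** * From tents to test functions *)

Section integral_convergence.
Context (disp : measure_display) (T : measurableType disp) (R : realType).
Variable m : nat -> {measure set T -> \bar R}.
Implicit Types f g S : T -> R.

(** Finite real integrals make this class closed under linear combinations. Integrability is asked
    of the limit and of large n only, since at an endpoint finitely many of the integrals may be
    infinite. *)
Definition int_cvg f := [/\ measurable_fun setT f,
  \forall n \near \oo, (m n).-integrable setT (EFin \o f),
  (m 0%N).-integrable setT (EFin \o f) &
  Rintegral (m n) setT f @[n --> \oo] --> Rintegral (m 0%N) setT f].

Lemma int_cvgD f g : int_cvg f -> int_cvg g -> int_cvg (fun x => f x + g x).
Proof.
move=> [mf If I0f cf] [mg Ig I0g cg]; split.
- exact: measurable_funD.
- by apply: filterS2 If Ig => n h1 h2; exact: (integrableD measurableT h1 h2).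
- exact: (integrableD measurableT I0f I0g).
rewrite RintegralD//.
apply: (@cvg_trans _ ((Rintegral (m n) setT f + Rintegral (m n) setT g) @[n --> \oo])).
  apply: near_eq_cvg; apply: filterS2 If Ig => n ? ?; exact/esym/RintegralD.
exact: cvgD.
Qed.

Lemma int_cvgZ k f : int_cvg f -> int_cvg (fun x => k * f x).
Proof.
move=> [mf If I0f cf]; split.
- exact: measurable_funM.
- by apply: filterS If => n h; exact: (integrableZl measurableT k h).
- exact: (integrableZl measurableT k I0f).
rewrite RintegralZl//.
apply: (@cvg_trans _ ((k * Rintegral (m n) setT f) @[n --> \oo])).
  apply: near_eq_cvg; apply: filterS If => n ?; exact/esym/RintegralZl.
by apply: cvgM => //; exact: cvg_cst.
Qed.

Lemma int_cvg_sum n (f : nat -> T -> R) : (forall i, (i < n)%N -> int_cvg (f i)) ->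
  int_cvg (fun x => \sum_(i < n) f i x).
Proof.
elim: n => [_|n IH H].
  have -> : (fun x => \sum_(i < 0) f i x) = (fun x => 0) by apply/funext => x; rewrite big_ord0.
  split=> //; first by apply: nearW => k; exact: integrable0.
    exact: integrable0.
  rewrite Rintegral_cst// mul0r.
  have -> : (fun n => Rintegral (m n) [set: T] (fun=> 0)) = fun=> 0.
    by apply/funext => k; rewrite Rintegral_cst// mul0r.
  exact: cvg_cst.
have -> : (fun x => \sum_(i < n.+1) f i x) = fun x => \sum_(i < n) f i x + f n x.
  by apply/funext => x; rewrite big_ord_recr.
by apply: int_cvgD; [apply: IH => i ilt; apply: H; exact: leqW|exact: H].
Qed.

(** Uniform approximation relative to a weight [S], which replaces the constants, as these need not
    be integrable. The integrals of [S] converge, hence stay bounded, so the error is small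
    uniformly in large n. *)
Lemma int_cvg_approx f S : measurable_fun setT f -> int_cvg S ->
  (forall e : R, 0 < e -> exists2 g, int_cvg g & forall x, `|f x - g x| <= e * S x) ->
  int_cvg f.
Proof.
move=> mf [mS IS I0S cS] H.
have S0 x : 0 <= S x.
  by have [g _ /(_ x)] := H 1 ltr01; rewrite mul1r; exact: le_trans.
have [g1 [mg1 Ig1 I0g1 _] fg1] := H 1 ltr01.
have If_of (mu : {measure set T -> \bar R}) :
    mu.-integrable setT (EFin \o g1) -> mu.-integrable setT (EFin \o S) ->
    mu.-integrable setT (EFin \o f).
  move=> h1 h2.
  have h3 : mu.-integrable setT (EFin \o (fun x => `|g1 x| + S x)).
    have h5 := integrable_norm h1.
    exact: (integrableD measurableT h5 h2).
  apply: (le_integrable measurableT _ _ h3); first exact/measurable_EFinP.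
  move=> x _; rewrite /= lee_fin [leRHS]ger0_norm ?addr_ge0//.
  have := fg1 x; rewrite mul1r => h4.
  have -> : f x = g1 x + (f x - g1 x) by rewrite addrC subrK.
  by rewrite (le_trans (ler_normD _ _))// lerD2l.
have If : \forall n \near \oo, (m n).-integrable setT (EFin \o f).
  by apply: filterS2 Ig1 IS => n; exact: If_of.
have I0f := If_of _ I0g1 I0S.
have close (mu : {measure set T -> \bar R}) e g :
    mu.-integrable setT (EFin \o f) -> mu.-integrable setT (EFin \o g) ->
    mu.-integrable setT (EFin \o S) -> (forall x, `|f x - g x| <= e * S x) ->
    `|Rintegral mu setT f - Rintegral mu setT g| <= e * Rintegral mu setT S.
  move=> h1 h2 h3 fg.
  have h4 : mu.-integrable setT (EFin \o (fun x => f x - g x)).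
    exact: (integrableB measurableT h1 h2).
  rewrite -RintegralB// (le_trans (le_normr_Rintegral _ h4))// -RintegralZl//.
  apply: le_Rintegral => //; last exact: (integrableZl measurableT e h3).
  exact: (integrable_norm h4).
split=> //; apply/cvgrPdist_le => eta eta0.
(* A bound for the integrals of [S] under the limit and, once they are within 1 of it, for large
   n. *)
pose B := Rintegral (m 0%N) setT S + 1.
have B0 : 0 <= Rintegral (m 0%N) setT S by apply: Rintegral_ge0.
have e0 : 0 < eta / 3 / B by rewrite !divr_gt0// /B; lra.
have [g [mg Ig I0g cg] fg] := H _ e0.
have eta3 : 0 < eta / 3 by lra.
have /cvgrPdist_le/(_ _ eta3) cg' := cg.
have /cvgrPdist_le/(_ _ ltr01) cS' := cS.
near=> n.
have IfN : (m n).-integrable setT (EFin \o f) by near: n.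
have IgN : (m n).-integrable setT (EFin \o g) by near: n.
have ISN : (m n).-integrable setT (EFin \o S) by near: n.
have hg : `|Rintegral (m 0%N) setT g - Rintegral (m n) setT g| <= eta / 3 by near: n.
have hS : `|Rintegral (m 0%N) setT S - Rintegral (m n) setT S| <= 1 by near: n.
have SB : Rintegral (m n) setT S <= B.
  by move: hS; rewrite ler_distlC /B => /andP[_]; lra.
have eB : eta / 3 / B * B = eta / 3 by rewrite divfK// gt_eqF// /B; lra.
have c1 := close (m n) _ _ IfN IgN ISN fg.
have c0 := close (m 0%N) _ _ I0f I0g I0S fg.
have c1' : `|Rintegral (m n) setT f - Rintegral (m n) setT g| <= eta / 3.
  by rewrite (le_trans c1)// -[leRHS]eB ler_wpM2l// ltW.
have c0' : `|Rintegral (m 0%N) setT f - Rintegral (m 0%N) setT g| <= eta / 3.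
  by rewrite (le_trans c0)// -[leRHS]eB ler_wpM2l ?(ltW e0)// /B; lra.
move: c1' c0' hg; rewrite !ler_distl => /andP[? ?] /andP[? ?] /andP[? ?].
by apply/andP; split; lra.
Unshelve. all: by end_near. Qed.

Lemma int_cvg_integral f : int_cvg f ->
  (\int[m n]_x (f x)%:E)%E @[n --> \oo] --> (\int[m 0%N]_x (f x)%:E)%E.
Proof.
move=> [mf If I0f cf]; rewrite -[X in _ --> X]fineK; last exact: integrable_fin_num.
apply/fine_cvgP; split=> //.
by apply: filterS If => n ?; exact: integrable_fin_num.
Qed.

Lemma integral_int_cvg f : measurable_fun setT f -> (forall x, 0 <= f x) ->
  (\int[m 0%N]_x (f x)%:E < +oo)%E ->
  (\int[m n]_x (f x)%:E)%E @[n --> \oo] --> (\int[m 0%N]_x (f x)%:E)%E ->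
  int_cvg f.
Proof.
move=> mf f0 fin.
have If (mu : {measure set T -> \bar R}) : (\int[mu]_x (f x)%:E < +oo)%E ->
    mu.-integrable setT (EFin \o f).
  move=> h; apply/integrableP; split; first exact/measurable_EFinP.
  by under eq_integral do rewrite /= ger0_norm//.
have fn : (\int[m 0%N]_x (f x)%:E)%E \is a fin_num.
  by rewrite ge0_fin_numE//; apply: integral_ge0 => x _; rewrite lee_fin.
rewrite -[X in _ --> X](fineK fn) => /fine_cvgP[nfin cf]; split=> //.
- by apply: filterS nfin => n h; apply: If; rewrite ltey_eq h.
- exact: If.
Qed.

End integral_convergence.

(** * Sums of tents on grids and compactly supported test functions *)

Section grids.
Variables (R : realType) (J : nd_interval R).
Local Notation state := (state J).
Implicit Types (x y : state).

(* On the grid [a + i * d] a tent is a second difference of ramps, so the sum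
   of the tents telescopes. *)
Lemma tent_grid_sum (a d : R) n y : 0 < d ->
  \sum_(i < n) tent (a + i.+1%:R * d) d y =
  (Num.max 0 (val y - a) - Num.max 0 (val y - (a + d))) -
  (Num.max 0 (val y - (a + n%:R * d)) - Num.max 0 (val y - (a + n.+1%:R * d))).
Proof.
move=> d0; rewrite /tent /dist_from; move: (val y) => v.
pose q i := Num.max 0 (v - (a + i%:R * d)).
have -> : Num.max 0 (v - a) = q 0%N by rewrite /q mul0r addr0.
have -> : Num.max 0 (v - (a + d)) = q 1%N by rewrite /q mul1r.
rewrite -/(q n) -/(q n.+1); elim: n => [|n IH]; first by rewrite big_ord0 subrr.
rewrite big_ord_recr /= {}IH.
suff : Num.max 0 (d - `|v - (a + n.+1%:R * d)|) = q n - q n.+1 - (q n.+1 - q n.+2) by lra.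
rewrite /q; have -> : a + n%:R * d = (a + n.+1%:R * d) - d by rewrite -natr1; lra.
have -> : a + n.+2%:R * d = (a + n.+1%:R * d) + d by rewrite -(natr1 n.+1); lra.
move: (a + n.+1%:R * d) => c.
have [|] := leP v c => vc; [rewrite ler0_norm ?subr_le0//|rewrite gtr0_norm ?subr_gt0//].
  rewrite (@max_l _ _ 0 (v - c)); last lra.
  rewrite (@max_l _ _ 0 (v - (c + d))); last lra.
  by rewrite !subr0; congr Num.max; lra.
rewrite (@max_r _ _ 0 (v - (c - d))); last lra.
rewrite (@max_r _ _ 0 (v - c)); last lra.
have [h|h] := leP (d - (v - c)) 0.
  by rewrite max_r; lra.
by rewrite max_l; lra.
Qed.

Definition to_state (r : R) : state :=
  if pselect (nd_set J r) is left Jr then projT1 (cid (exists_state Jr)) else point.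

Lemma val_to_state r : nd_set J r -> val (to_state r) = r.
Proof. by rewrite /to_state; case: pselect => // Jr _; case: cid. Qed.

Lemma inJo_itv (a b r : R) : inJo J a -> inJo J b -> a <= r <= b -> inJo J r.
Proof.
move=> Ia Ib /andP[]; rewrite le_eqVlt => /predU1P[<-//|ar].
rewrite le_eqVlt => /predU1P[->//|rb].
by apply: (inJo_between (inJo_mem Ia) (inJo_mem Ib)); rewrite ar.
Qed.

Lemma inJo_widen (a b : R) : inJo J a -> inJo J b ->
  exists a' b' : R, [/\ inJo J a', inJo J b', a' < a & b < b'].
Proof.
move=> Ia Ib; have [e e0 He] := inJo_near Ia; have [e' e'0 He'] := inJo_near Ib.
exists (a - e / 2), (b + e' / 2); split; try lra.
  by apply: He; rewrite addrC addKr normrN gtr0_norm; lra.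
by apply: He'; rewrite addrC addKr gtr0_norm; lra.
Qed.

Section integral_convergence.
Variable m : nat -> {measure set state -> \bar R}.
Hypothesis lf : forall n, locally_finite_inner (m n).
Hypothesis tent_cvg : forall c x d, adm c x d ->
  (\int[m n]_y (tent (val x) d y)%:E)%E @[n --> \oo] -->
  (\int[m 0%N]_y (tent (val x) d y)%:E)%E.

Lemma int_cvg_tent_inner z d : 0 < d -> inJo J (z - d) -> inJo J (z + d) ->
  int_cvg m (tent z d).
Proof.
move=> d0 h1 h2.
have Jz : nd_set J z.
  by apply/inJo_mem/(inJo_itv h1 h2); apply/andP; split; lra.
have zE := val_to_state Jz; rewrite -zE in h1 h2 *.
apply: integral_int_cvg.
- exact: measurable_tent.
- by move=> y; exact: tent_ge0.
- exact: tent_finite_inner.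
- by apply: (@tent_cvg 1); split=> //; exact: Or31.
Qed.

(** There are [n + 1] steps but only [n] tents, centered at the inner grid points, so that their
    supports stay in [a, b]. *)
Lemma tent_grid (a b e : R) : inJo J a -> inJo J b -> a < b -> 0 < e ->
  exists d n, [/\ 0 < d, d < e, a + n.+1%:R * d = b,
    forall i, (i < n)%N -> a <= a + i.+1%:R * d <= b &
    forall i, (i < n)%N -> int_cvg m (tent (a + i.+1%:R * d) d)].
Proof.
move=> Ia Ib ab e0.
pose n := Num.truncn ((b - a) / e).
pose d := (b - a) / n.+1%:R.
have d0 : 0 < d by rewrite divr_gt0// subr_gt0.
have nd : n.+1%:R * d = b - a by rewrite mulrC divfK.
have ile i : (i < n)%N -> i.+2%:R * d <= b - a.
  by move=> ilt; rewrite -nd ler_pM2r// ler_nat.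
exists d, n; split=> //.
- rewrite ltr_pdivrMr// mulrC -ltr_pdivrMr//; exact: truncnS_gt.
- by rewrite nd addrC subrK.
- move=> i ilt; have := ile i ilt; rewrite -natr1 => h.
  have : 0 <= i.+1%:R * d by rewrite mulr_ge0// ltW.
  by move=> h'; apply/andP; split; lra.
move=> i ilt; have := ile i ilt; rewrite -natr1 => h.
have h' : 0 <= i%:R * d by rewrite mulr_ge0// ltW.
apply: int_cvg_tent_inner => //.
  by apply: (inJo_itv Ia Ib); rewrite -natr1; apply/andP; split; lra.
by apply: (inJo_itv Ia Ib); rewrite -natr1; apply/andP; split; lra.
Qed.

(** The tents of a grid add up to a trapezoid of height [d]; widening [a, b] first leaves room for
    its two slopes. *)
Lemma int_cvg_bump (a b : R) : inJo J a -> inJo J b ->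
  exists S : state -> R, [/\ int_cvg m S, forall y, 0 <= S y &
    forall y, a <= val y <= b -> S y = 1].
Proof.
move=> Ia Ib; have [a' [b' [Ia' Ib' a'a bb']]] := inJo_widen Ia Ib.
have [ab|ba] := leP a b; last first.
  (* For an empty segment the zero function serves, written as an empty sum. *)
  exists (fun y => \sum_(i < 0) tent 0 0 y); split.
  - by apply: (@int_cvg_sum _ _ _ m 0 (fun _ => tent 0 0)).
  - by move=> y; rewrite big_ord0.
  - by move=> y /andP[/le_trans h /h]; rewrite leNgt ba.
have e0 : 0 < Num.min (a - a') (b' - b) by rewrite lt_min !subr_gt0 a'a.
have a'b' : a' < b' by lra.
have [d [n [d0 de dn _ Hn]]] := tent_grid Ia' Ib' a'b' e0.
exists (fun y => d^-1 * \sum_(i < n) tent (a' + i.+1%:R * d) d y); split.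
- by apply: int_cvgZ; exact: (@int_cvg_sum _ _ _ m n (fun i => tent (a' + i.+1%:R * d) d)).
- by move=> y; rewrite mulr_ge0 ?invr_ge0 ?(ltW d0)// sumr_ge0// => i _; exact: tent_ge0.
move=> y /andP[ay yb]; rewrite tent_grid_sum//.
have da : d < a - a' by rewrite (lt_le_trans de)// ge_min lexx.
have db : d < b' - b by rewrite (lt_le_trans de)// ge_min lexx orbT.
have nE : a' + n%:R * d = b' - d by rewrite -dn -natr1; lra.
rewrite dn nE (@max_r _ _ 0 (val y - a')); last lra.
rewrite (@max_r _ _ 0 (val y - (a' + d))); last lra.
rewrite (@max_l _ _ 0 (val y - (b' - d))); last lra.
rewrite (@max_l _ _ 0 (val y - b')); last lra.
rewrite (_ : _ - _ - _ = d); last lra.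
by rewrite mulVf// gt_eqF.
Qed.

(** Heine-Cantor on a compact segment, with the second point free to lie outside it. *)
Lemma uniform_modulus (f : state -> R) (a b e : R) : continuous f ->
  inJo J a -> inJo J b -> 0 < e ->
  exists2 d : R, 0 < d & forall x y, a <= val x <= b -> `|val x - val y| < d ->
    `|f x - f y| < e.
Proof.
move=> cf Ia Ib e0.
pose Q (d : R) x := forall y, `|val x - val y| < d -> `|f x - f y| < e.
have : \forall d \near 0^'+, seg a b `<=` Q d.
  apply: (compact_near_coveringP _).1 => // [|x _]; first exact: seg_compact.
  have e2 : 0 < e / 2 by lra.
  have fx : \forall y \near x, `|f x - f y| < e / 2.
    by have /cvgrPdist_lt := cf x; exact.
  have [r /= r0 Hr] := (nbhs_ballP x _).1 fx.
  have Hr' y : `|val x - val y| < r -> `|f x - f y| < e / 2 by exact: Hr.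
  have r2 : 0 < r / 2 by lra.
  exists ([set y | `|val x - val y| < r / 2], [set d | d < r / 2]).
    split; last exact: nbhs_right_lt.
    by apply/nbhs_ballP; exists (r / 2).
  move=> [y d] /= [xy dr] z yz.
  have -> : f y - f z = (f x - f z) - (f x - f y) by lra.
  rewrite (le_lt_trans (ler_normB _ _))//.
  have h1 : `|f x - f y| < e / 2 by apply: Hr'; lra.
  have h2 : `|f x - f z| < e / 2.
    apply: Hr'; have -> : val x - val z = (val x - val y) + (val y - val z) by lra.
    by rewrite (le_lt_trans (ler_normD _ _))//; lra.
  lra.
move=> H.
have [d [d0 Hd]] : exists d, 0 < d /\ seg a b `<=` Q d.
  near (0 : R)^'+ => d; exists d; split; first by [].
  by near: d.
by exists d => // x y xab; exact: Hd.
Unshelve. all: by end_near. Qed.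

(** [f] is approximated by its piecewise linear interpolation on a grid, a combination of tents with
    coefficients f(z_i) / d because a tent has height [d]. *)
Lemma int_cvg_compact_support (f : state -> R) (a b : R) : continuous f ->
  inJo J a -> inJo J b ->
  (forall y, ~~ (a <= val y <= b) -> f y = 0) -> int_cvg m f.
Proof.
move=> cf Ia Ib f0.
have [a' [b' [Ia' Ib' a'a bb']]] := inJo_widen Ia Ib.
have [S [cS S0 S1]] := int_cvg_bump Ia' Ib'.
have mf := continuous_measurable_state cf.
have [ab|ba] := leP a b; last first.
  apply: (int_cvg_approx mf cS) => e e0; exists (fun y => 0 * S y); first exact: int_cvgZ.
  move=> y; rewrite f0 ?mul0r ?subrr ?normr0 ?mulr_ge0 ?(ltW e0)//.
  by apply/negP => /andP[/le_trans h /h]; rewrite leNgt ba.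
have a'b' : a' < b' by lra.
apply: (int_cvg_approx mf cS) => e e0.
have [w w0 Hw] := uniform_modulus cf Ia' Ib' e0.
(* The mesh has to resolve the oscillation of [f] and to fit into the margins between [a, b] and
   [a', b']. *)
have w'0 : 0 < Num.min w (Num.min (a - a') (b' - b)).
  by rewrite !lt_min w0 !subr_gt0 a'a.
have [d [n [d0 dlt dn ile Hn]]] := tent_grid Ia' Ib' a'b' w'0.
have [dw da db] : [/\ d < w, d < a - a' & d < b' - b].
  by move: dlt; rewrite !lt_min => /and3P[].
pose z i := a' + i.+1%:R * d.
exists (fun y => \sum_(i < n) (f (to_state (z i)) / d) * tent (z i) d y).
  apply: (@int_cvg_sum _ _ _ m n (fun i y => (f (to_state (z i)) / d) * tent (z i) d y)).
  by move=> i ilt; apply: int_cvgZ; exact: Hn.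
move=> y; set s := \sum_(i < n) tent (z i) d y.
have sE : s = _ := tent_grid_sum a' n y d0.
have nE : a' + n%:R * d = b' - d by rewrite -dn -natr1; lra.
rewrite dn nE in sE.
have s_le : s <= d * S y.
  have [yab|yab] := boolP (a' <= val y <= b').
    rewrite S1// mulr1 sE; case/andP: yab => h1 h2.
    have h3 : Num.max 0 (val y - b') <= Num.max 0 (val y - (b' - d)).
      by rewrite ge_max !le_max lexx/=; apply/orP; right; lra.
    have h4 : Num.max 0 (val y - a') <= d + Num.max 0 (val y - (a' + d)).
      rewrite ge_max addr_ge0 ?(ltW d0) ?le_max ?lexx//= -lerBlDl le_max.
      by apply/orP; right; lra.
    lra.
  rewrite sE; apply: (@le_trans _ _ 0); last by rewrite mulr_ge0// ltW.
  move: yab; rewrite negb_and -!ltNge => /orP[h|h].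
    by rewrite !max_l; lra.
  by rewrite !max_r; lra.
(* On [a, b] the tents add up to [d] exactly; elsewhere [f] vanishes. *)
have fs : f y * s = f y * d.
  have [/andP[h1 h2]|yab] := boolP (a <= val y <= b); last by rewrite f0// !mul0r.
  congr (_ * _); rewrite sE (@max_r _ _ 0 (val y - a')); last lra.
  rewrite (@max_r _ _ 0 (val y - (a' + d))); last lra.
  rewrite (@max_l _ _ 0 (val y - (b' - d))); last lra.
  by rewrite (@max_l _ _ 0 (val y - b')); lra.
have -> : f y - \sum_(i < n) f (to_state (z i)) / d * tent (z i) d y =
    \sum_(i < n) (f y - f (to_state (z i))) / d * tent (z i) d y.
  under [RHS]eq_bigr do rewrite mulrBl mulrBl.
  rewrite sumrB; congr (_ - _); rewrite -mulr_sumr -/s mulrAC fs mulfK// gt_eqF//.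
apply: (le_trans (ler_norm_sum _ _ _)).
apply: (@le_trans _ _ (\sum_(i < n) e / d * tent (z i) d y)).
  apply: ler_sum => i _; rewrite normrM (ger0_norm (tent_ge0 _ _ _)).
  (* Only tents centered within [d < w] of [y] contribute, and there [f] varies by less than [e]. *)
  have [->|tn0] := eqVneq (tent (z i) d y) 0; first by rewrite !mulr0.
  rewrite ler_wpM2r ?tent_ge0// normrM (gtr0_norm (x := d^-1)) ?invr_gt0//.
  rewrite ler_wpM2r ?invr_ge0 ?(ltW d0)//.
  have zab := ile i (ltn_ord i).
  have zJ : nd_set J (z i) by exact/inJo_mem/(inJo_itv Ia' Ib').
  rewrite distrC ltW// Hw ?val_to_state// (lt_trans _ dw)// distrC.
  rewrite ltNge; apply/negP => yz; move: tn0; rewrite /tent max_l ?eqxx//.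
  by rewrite subr_le0.
rewrite -mulr_sumr -/s -mulrA ler_wpM2l ?(ltW e0)//.
by rewrite mulrC ler_pdivrMr// mulrC.
Qed.

End integral_convergence.
End grids.

(** * Test functions in the interior and at the endpoints *)

Section speed_convergence.
Variables (R : realType) (J : nd_interval R).
Local Notation state := (state J).
Local Notation Jo := (@inner R J).
Implicit Types (x y z : state).
Variable m : nat -> {measure set state -> \bar R}.
Hypothesis lf : forall n, locally_finite_inner (m n).
Hypothesis tent_cvg : forall c x d, adm c x d ->
  (\int[m n]_y (tent (val x) d y)%:E)%E @[n --> \oo] -->
  (\int[m 0%N]_y (tent (val x) d y)%:E)%E.

Lemma inner_cvg (f : state -> R) : continuous f ->
  (exists K, [/\ compact K, K `<=` Jo & forall x, ~ K x -> f x = 0]) ->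
  (\int[m n]_(x in Jo) (f x)%:E)%E @[n --> \oo] -->
  (\int[m 0%N]_(x in Jo) (f x)%:E)%E.
Proof.
move=> cf [K [cK KJ f0]].
have innerE (mu : {measure set state -> \bar R}) :
    (\int[mu]_(x in Jo) (f x)%:E = \int[mu]_x (f x)%:E)%E.
  by apply: integral_inner => x Jx; rewrite f0// => /KJ.
rewrite innerE; under eq_fun do rewrite innerE.
have [K0|] := eqVneq K set0.
  have fE : f = fun=> 0 by apply/funext => x; rewrite f0// K0.
  rewrite fE integral0; under eq_fun do rewrite integral0.
  exact: cvg_cst.
move=> /set0P K0; apply: int_cvg_integral.
have cv : {within K, continuous (val : state -> R)}.
  by apply: continuous_subspaceT; exact: continuous_state_val.
have [a aK amin] := compact_EVT_min K0 cK cv.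
have [b bK bmax] := compact_EVT_max K0 cK cv.
rewrite !inE in aK bK.
apply: (int_cvg_compact_support lf tent_cvg cf (KJ a aK) (KJ b bK)) => y yab.
rewrite f0// => Ky; move: yab; rewrite negb_and -!ltNge => /orP[|].
  by rewrite ltNge amin// inE.
by rewrite ltNge bmax// inE.
Qed.

Lemma endpoint_cvg c z D (f : state -> R) : adm c z D -> continuous f ->
  (forall x, 0 <= f x) -> 0 < f z ->
  (forall y, D <= dist_from (val z) y -> f y = 0) ->
  (\int[m n]_x (f x)%:E)%E @[n --> \oo] --> (\int[m 0%N]_x (f x)%:E)%E.
Proof.
move=> azD cf f0 fz fD; have D0 : 0 < D by case: azD.
have near_z (g : state -> R) e : continuous g -> 0 < e ->
    exists2 r : R, 0 < r & forall y, dist_from (val z) y < r -> `|g z - g y| < e.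
  move=> cg e0.
  have : \forall y \near z, `|g z - g y| < e by have /cvgrPdist_lt := cg z; exact.
  move=> /nbhs_ballP[r /= r0 Hr]; exists r => // y yr; apply: Hr.
  by move: yr; rewrite /dist_from distrC.
have fz2 : 0 < f z / 2 by lra.
have [r r0 Hr] := near_z f _ cf fz2.
pose d := Num.min (r / 2) D.
have d0 : 0 < d by rewrite lt_min D0 andbT; lra.
have dD : d <= D by rewrite ge_min lexx orbT.
have dr : d < r by rewrite gt_min; apply/orP; left; lra.
have azd : adm c z d by exact: adm_le azD d0 dD.
(* On the ball of radius [d] the function [f] exceeds f z / 2 = k * d, the maximum of [k] times the
   tent; hence [f] dominates that multiple and inherits an infinite integral. *)
pose k := f z / 2 / d; have k0 : 0 < k by rewrite divr_gt0.
have tent_le y : tent (val z) d y <= d.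
  by rewrite /tent ge_max (ltW d0) gerBl /dist_from normr_ge0.
have ftent y : k * tent (val z) d y <= f y.
  have [yd|dy] := ltP (dist_from (val z) y) d; last first.
    by rewrite /tent max_l ?mulr0// subr_le0.
  apply: (@le_trans _ _ (f z / 2)).
    by rewrite -[leRHS](divfK (lt0r_neq0 d0)) ler_wpM2l// ltW.
  have := Hr y (lt_trans yd dr); rewrite ltr_distlC => /andP[]; lra.
have mulE (mu : {measure set state -> \bar R}) :
    (k%:E * \int[mu]_y (tent (val z) d y)%:E <= \int[mu]_y (f y)%:E)%E.
  rewrite -ge0_integralZl_EFin ?(ltW k0)//; last 2 first.
  - by move=> y _; rewrite lee_fin tent_ge0.
  - exact: measurable_EFin_tent.
  apply: ge0_le_integral_nomeas => y _; rewrite -EFinM lee_fin//.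
  by rewrite mulr_ge0 ?(ltW k0)// tent_ge0.
have [tinf|tfin] := eqVneq (\int[m 0%N]_y (tent (val z) d y)%:E)%E +oo%E.
  have -> : (\int[m 0%N]_y (f y)%:E)%E = +oo%E.
    by apply/eqP; rewrite -leye_eq (le_trans _ (mulE _))// tinf gt0_muley// lte_fin.
  apply/cvgeyPgt => A.
  have := tent_cvg azd; rewrite tinf => /cvgeyPgt /(_ (A / k)).
  apply: filterS => n h; apply: lt_le_trans (mulE _).
  by rewrite -[A](divfK (lt0r_neq0 k0)) mulrC EFinM lte_pmul2l// lte_fin.
have {}tfin : (\int[m 0%N]_y (tent (val z) d y)%:E < +oo)%E by rewrite ltey.
have ct : int_cvg m (tent (val z) d).
  apply: integral_int_cvg => //; first exact: measurable_tent.
    by move=> y; exact: tent_ge0.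
  exact: tent_cvg azd.
apply: int_cvg_integral.
(* The tent has value [d] at [z], so this coefficient makes [g] vanish there, and only mass away
   from [z] matters for the rest. *)
pose g y := f y - f z / d * tent (val z) d y.
have cg : continuous g.
  move=> y; apply: (@continuousB R R^o state f (fun y => f z / d * tent (val z) d y)).
    exact: cf.
  apply: (@continuousM R state (cst (f z / d)) (tent (val z) d)).
    exact: cst_continuous.
  exact: continuous_tent.
have gz : g z = 0.
  by rewrite /g /tent dist_from_start subr0 max_r ?(ltW d0)// divfK ?subrr// gt_eqF.
have gD y : D <= dist_from (val z) y -> g y = 0.
  by move=> yD; rewrite /g fD// /tent max_l ?mulr0 ?subr0// subr_le0 (le_trans dD).
suff cvgg : int_cvg m g.
  have -> : f = fun y => g y + f z / d * tent (val z) d y.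
    by apply/funext => y; rewrite /g subrK.
  by apply: int_cvgD => //; exact: int_cvgZ.
have d2 : 0 < d / 2 by lra.
have d2D : d / 2 < D by lra.
have [a [b [Ia Ib _ ann]]] := adm_annulus azD d2 d2D.
have [S [cS S0 S1]] := int_cvg_bump lf tent_cvg Ia Ib.
(* This weight is at least 1 on the ball of radius [D]: the scaled tent covers radius [d / 2], the
   bump covers the remaining annulus. *)
have cS' : int_cvg m (fun y => 2 / d * tent (val z) d y + S y).
  by apply: int_cvgD => //; exact: int_cvgZ.
apply: (int_cvg_approx (continuous_measurable_state cg) cS') => e e0.
(* Truncating the small values of [g] makes its support compact in the
   interior. *)
pose clamp (v : R) := Num.max (- e) (Num.min e v).
have clamp_id v : `|v| <= e -> clamp v = v.
  by rewrite ler_norml => /andP[h1 h2]; rewrite /clamp (min_idPr h2) (max_idPr h1).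
have clamp_le v : `|clamp v| <= e.
  rewrite ler_norml /clamp le_max lexx ge_max ge_min lexx/= andbT; lra.
exists (fun y => g y - clamp (g y)); last first.
  move=> y; rewrite opprB addrC subrK.
  have s0 : 0 <= 2 / d * tent (val z) d y + S y.
    by rewrite addr_ge0// mulr_ge0 ?tent_ge0// divr_ge0// ltW.
  have [/gD ->|yD] := leP D (dist_from (val z) y).
    by rewrite clamp_id normr0 ?(ltW e0)// mulr_ge0// ltW.
  rewrite (le_trans (clamp_le _))// -[leLHS]mulr1 ler_wpM2l ?(ltW e0)//.
  have [yd|dy] := ltP (dist_from (val z) y) (d / 2).
    have : d / 2 <= tent (val z) d y by rewrite /tent le_max; apply/orP; right; lra.
    move=> /(ler_wpM2l (ltW (divr_gt0 (ltr0n R 2) d0))).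
    have -> : 2 / d * (d / 2) = 1 by field; rewrite gt_eqF.
    by have := S0 y; lra.
  rewrite S1; last exact: ann dy (ltW yD).
  by rewrite lerDr mulr_ge0 ?tent_ge0// divr_ge0// ltW.
have [r' r'0 Hr'] := near_z g e cg e0.
(* Within [r'] of [z] the truncation removes [g] entirely, so what is left is supported in the
   annulus between [q] and [D]. *)
pose q := Num.min r' (D / 2).
have q0 : 0 < q by rewrite lt_min r'0; lra.
have qD : q < D by rewrite gt_min; apply/orP; right; lra.
have [a' [b' [Ia' Ib' _ ann']]] := adm_annulus azD q0 qD.
apply: (int_cvg_compact_support lf tent_cvg _ Ia' Ib').
  move=> y; apply: (@continuousB R R^o state g (clamp \o g)); first exact: cg.
  apply: continuous_comp; first exact: cg.
  apply: (@continuous_max R R (cst (- e)) (fun v => Num.min e v)).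
    exact: cst_continuous.
  by apply: (@continuous_min R R (cst e) id); [exact: cst_continuous|exact: cvg_id].
move=> y yab; apply/eqP; rewrite subr_eq0 eq_sym; apply/eqP/clamp_id.
have [/gD ->|yD] := leP D (dist_from (val z) y); first by rewrite normr0 ltW.
have [yq|qy] := ltP (dist_from (val z) y) q; last first.
  by rewrite (ann' y qy (ltW yD)) in yab.
have yr' : dist_from (val z) y < r' by rewrite (lt_le_trans yq)// ge_min lexx.
by have := Hr' y yr'; rewrite gz sub0r normrN => /ltW.
Qed.

Lemma left_end_lt (l : state) y : is_left_end l -> Jo y -> val l < val y.
Proof.
move=> ll Jy; have [e e0 He] := inJo_near Jy.
have Iu : inJo J (val y - e / 2) by apply: He; rewrite addrC addKr normrN gtr0_norm; lra.
have [u uE _] := inJo_state Iu.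
have := ll u; rewrite uE; lra.
Qed.

Lemma right_end_gt (r : state) y : is_right_end r -> Jo y -> val y < val r.
Proof.
move=> rr Jy; have [e e0 He] := inJo_near Jy.
have Iu : inJo J (val y + e / 2) by apply: He; rewrite addrC addKr gtr0_norm; lra.
have [u uE _] := inJo_state Iu.
have := rr u; rewrite uE; lra.
Qed.

End speed_convergence.

Theorem theorem1p6 (R : realType) (J : nd_interval R)
  (m : nat -> {measure set (state J) -> \bar R})
  (P : nat -> state J -> probability (path_space J) R)
  (P_diffusion : forall n, diffusion (P n))
  (P_regular : forall n, regular_diffusion (P n))
  (P_natural : forall n, natural_scale (P n))
  (P_speed : forall n, speed_measure_of (P n) (m n))
  (P_cvg : forall x : state J, weak_cvg (fun n => P n x) (P 0%N x)) :
  speed_cvg m (m 0%N).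
Proof.
have lf n : locally_finite_inner (m n) by case: (P_speed n).
have tent_cvg c x d := @tent_integral_cvg R J P m P_diffusion P_speed P_cvg c x d.
split; first exact: inner_cvg.
- move=> l ll f cf f0 fl [y Jy fy].
  have ly := left_end_lt ll Jy.
  have yE : val l + (val y - val l) = val y by rewrite addrC subrK.
  have adml : adm 2 l (val y - val l).
    by split; [rewrite subr_gt0|apply: Or32; rewrite yE].
  apply: (endpoint_cvg lf tent_cvg adml cf f0 fl) => u.
  by rewrite /dist_from ger0_norm ?subr_ge0// lerD2r => /fy.
- move=> r rr f cf f0 fr [y Jy fy].
  have yr := right_end_gt rr Jy.
  have yE : val r - (val r - val y) = val y by rewrite opprB addrC subrK.
  have admr : adm 2 r (val r - val y).
    by split; [rewrite subr_gt0|apply: Or33; rewrite yE].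
  apply: (endpoint_cvg lf tent_cvg admr cf f0 fr) => u.
  by rewrite /dist_from ler0_norm ?subr_le0// opprB lerD2l lerN2 => /fy.
Qed.
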